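(* Let $\alpha,q\in(-1,1)$, $n\ge 1$. For every $i\in\{1,\dots,n\}$ let $x_{\bar i}\otimes x_i\in H_{\mathbb R}\otimes H_{\mathbb R}$ with $x_{\bar i},x_i\in D\cap H_{\mathbb R}$, let $\lambda_{\bar i},\lambda_i\in\mathbb R$, and let $T_{\bar i},T_i$ be operators on $H$ defined on the common dense domain $D$ and mapping $D$ into $D$. Let $B^{\lambda_{\bar i},\lambda_i}_{\alpha,q}(x_{\bar i}\otimes x_i)$ be the corresponding double Poisson operators of type B and $\varphi$ the vacuum state. Then $$\varphi\big(B^{\lambda_{\bar n},\lambda_n}_{\alpha,q}(x_{\bar n}\otimes x_n)\cdots B^{\lambda_{\bar 1},\lambda_1}_{\alpha,q}(x_{\bar 1}\otimes x_1)\big)=\sum_{\pi\in\mathcal P^B(n)}\alpha^{\mathrm{Na}(\pi)}\,q^{\mathrm{Rc}(\pi)}\,R_\pi^{x,T,\lambda}.$$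
   Context: Notation: $\bar i=-i$, $[\pm n]=\{\bar n,\dots,\bar 1,1,\dots,n\}$, $0^0=1$. A check over a factor means it is omitted. Fock space. $H_{\mathbb R}$ is a separable real Hilbert space, $H$ its complexification with inner product linear in the right argument and anti-linear in the left. $\mathcal K_n=H^{\otimes n}\otimes H^{\otimes n}$, with elements written $x_{\bar n}\otimes\cdots\otimes x_{\bar 1}\otimes x_1\otimes\cdots\otimes x_n$; $\mathcal K_0=\mathbb C\,(\Omega\otimes\Omega)$ with $\Omega\otimes\Omega$ a unit vector. $\mathcal F_{\rm fin}=\bigoplus_{n\ge0}\mathcal K_n$ (algebraic direct sum) with the free inner product $\langle\cdot,\cdot\rangle_{0,0}$. $B(n)$ is the hyperoctahedral group, i.e. the permutations $\sigma$ of $[\pm n]$ with $\sigma(\bar i)=\overline{\sigma(i)}$, generated by $\pi_0$ (exchanging $1,\bar1$) and $\pi_i$ (exchanging $i,i+1$ and $\bar i,\overline{i+1}$), $1\le i\le n-1$; for $\sigma$ written as a word of minimal length, $l_1(\sigma)$ is the number of occurrences of $\pi_0$ and $l_2(\sigma)$ that of $\pi_1,\dots,\pi_{n-1}$. $\sigma$ acts on $\mathcal K_n$ by $y_{\bar n}\otimes\cdots\otimes y_n\mapsto y_{\sigma^{-1}(\bar n)}\otimes\cdots\otimes y_{\sigma^{-1}(n)}$. $P^{(n)}_{\alpha,q}=\sum_{\sigma\in B(n)}\alpha^{l_1(\sigma)}q^{l_2(\sigma)}\sigma$, $P^{(0)}_{\alpha,q}=I$; for $f\in\mathcal K_n$,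 $g\in\mathcal K_m$, $\langle f,g\rangle_{\alpha,q}=\delta_{m,n}\langle f,P^{(n)}_{\alpha,q}g\rangle_{0,0}$. Operators. For $x,y\in H_{\mathbb R}$ and $\eta=x_{\bar n}\otimes\cdots\otimes x_n$: $b^*_{\alpha,q}(x\otimes y)\eta=x\otimes\eta\otimes y$, $b^*_{\alpha,q}(x\otimes y)(\Omega\otimes\Omega)=x\otimes y$. Its adjoint for $\langle\cdot,\cdot\rangle_{\alpha,q}$ is $b_{\alpha,q}(x\otimes y)$, which kills $\Omega\otimes\Omega$ and satisfies, with $\eta_k=x_{\bar n}\otimes\cdots\otimes\check x_{\bar k}\otimes\cdots\otimes x_{\bar1}\otimes x_1\otimes\cdots\otimes\check x_k\otimes\cdots\otimes x_n$ (and $\eta_1=\Omega\otimes\Omega$ if $n=1$), $$b_{\alpha,q}(x\otimes y)\eta=\sum_{k=1}^n q^{n-k}\langle x,x_{\bar k}\rangle\langle y,x_k\rangle\,\eta_k+\alpha q^{n-1}\sum_{k=1}^n q^{k-1}\langle x,x_k\rangle\langle y,x_{\bar k}\rangle\,\eta_k .$$ $D\subset H$ is a dense subspace. For operators $\bar T,T$ with domain $D$, mapping $D$ into $D$ (no relation between them is assumed), the gauge operator $p(\bar T\otimes T)$ kills $\Omega\otimes\Omega$ and, for $\eta\in D^{\otimes n}\otimes D^{\otimes n}$, $$p(\bar T\otimes T)\eta=\sum_{k=1}^n q^{n-k}\,\bar T x_{\bar k}\otimes\eta_k\otimes Tx_k+\alpha q^{n-1}\sum_{k=1}^n q^{k-1}\,\bar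 Tx_k\otimes\eta_k\otimes Tx_{\bar k}$$ (for $n=1$ the factor $\eta_1$ is dropped). The double Poisson operator of type B is $B^{\lambda_{\bar i},\lambda_i}_{\alpha,q}(x_{\bar i}\otimes x_i)=b_{\alpha,q}(x_{\bar i}\otimes x_i)+b^*_{\alpha,q}(x_{\bar i}\otimes x_i)+p(T_{\bar i}\otimes T_i)+\lambda_{\bar i}\lambda_i I$. The vacuum state is $\varphi(A)=\langle\Omega\otimes\Omega,A(\Omega\otimes\Omega)\rangle_{\alpha,q}$. Partitions of type B. $\mathcal P^B(n)$ is the set of partitions $\pi$ of $[\pm n]$ invariant under $i\mapsto\bar i$ in which no block equals its own reflection. Hence blocks come in pairs $(\bar V,V)$ of distinct blocks, and a block does not contain both $i$ and $\bar i$. Such a pair is a B-block, written $\mathbf B=((\bar i_m,\dots,\bar i_1),(i_1,\dots,i_m))$ where $|i_1|<\cdots<|i_m|$ and $i_m>0$ (so the first component is the reflection of the second). If $m=1$ it is a singleton. The B-arcs of $\mathbf B$ ($m\ge2$) are the $m-1$ pairs consisting of the arc joining $i_j$ and $i_{j+1}$ and its reflection joining $\bar i_j$ and $\bar i_{j+1}$, $1\le j\le m-1$. A B-arc is positive if $i_j,i_{j+1}$ have the same sign and negative if they have opposite signs. $\mathrm{Na}(\pi)$ is the number of negative B-arcs of $\pi$. Crossings. Two arcs with endpoints $i<j$ and $i'<j'$ cross if $i<i'<j<j'$ or $i'<i<j'<j$. $\mathrm{Rc}(\pi)$ is the sum, over unordered pairs of distinct B-arcs $(\bar V,V),(\bar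 W,W)$ of $\pi$, of the number of true statements among ''$V$ crosses $W$'' and ''$\bar V$ crosses $W$''. Cumulants. For a B-block $\mathbf B=((\bar i_m,\dots,\bar i_1),(i_1,\dots,i_m))$ with $|i_1|<\cdots<|i_m|$ and $i_m>0$, $R^{x,T,\lambda}(\mathbf B)=\lambda_{\bar i_1}\lambda_{i_1}$ if $m=1$, and otherwise $$R^{x,T,\lambda}(\mathbf B)=\langle x_{\bar i_m},T_{\bar i_{m-1}}\cdots T_{\bar i_2}x_{\bar i_1}\rangle\,\langle x_{i_m},T_{i_{m-1}}\cdots T_{i_2}x_{i_1}\rangle$$ (no $T$'s when $m=2$). $R_\pi^{x,T,\lambda}=\prod_{\mathbf B}R^{x,T,\lambda}(\mathbf B)$ over all B-blocks of $\pi$. *)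

(* Defs.v *)
From HB Require Import structures.
From mathcomp Require Import all_boot all_order all_algebra all_fingroup.
From mathcomp Require Import all_classical all_reals topology normedtype.
From mathcomp Require Import sesquilinear complex ring.

Set Implicit Arguments.
Unset Strict Implicit.
Unset Printing Implicit Defensive.

Import Order.TTheory GRing.Theory Num.Theory numFieldNormedType.Exports.

Local Open Scope ring_scope.

(* The pair (a, b) stands for a + i b. *)
Definition complexification (R : realType) (HR : completeNormedModType R) :
  Type := (HR * HR)%type.

Section Complexification.
Variables (R : realType) (HR : completeNormedModType R).
Local Notation H := (complexification HR).

(* The product topology is the topology of the Hilbert norm on H. *)
HB.instance Definition _ := GRing.Zmodule.copy H (HR * HR)%type.
HB.instance Definition _ := Topological.copy H (HR * HR)%type.

Definition cscale (z : R[i]) (v : H) : H :=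
  (complex.Re z *: v.1 - complex.Im z *: v.2,
   complex.Re z *: v.2 + complex.Im z *: v.1).

Fact cscaleA a b v : cscale a (cscale b v) = cscale (a * b) v.
Proof.
case: a b v => [a a'] [b b'] [x y]; rewrite /cscale /=; congr pair.
  rewrite scalerBr scalerDr scalerBl scalerDl !scalerA !opprD.
  by rewrite [X in _ + X]addrC addrACA.
rewrite scalerBr scalerDr scalerBl scalerDl !scalerA.
by rewrite [X in _ + X]addrC addrACA.
Qed.

Fact cscale1 : left_id 1 cscale.
Proof.
by move=> [x y]; rewrite /cscale /= !scale1r !scale0r subr0 addr0.
Qed.

Fact cscaleDr : right_distributive cscale +%R.
Proof.
move=> a [x y] [x' y']; rewrite /cscale /=; congr pair.
  by rewrite !scalerDr opprD addrACA.
by rewrite !scalerDr addrACA.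
Qed.

Fact cscaleDl v : {morph cscale^~ v : a b / a + b}.
Proof.
move=> [a a'] [b b']; case: v => x y; rewrite /cscale /=; congr pair.
  by rewrite !scalerDl opprD addrACA.
by rewrite !scalerDl addrACA.
Qed.

HB.instance Definition _ :=
  GRing.Zmodule_isLmodule.Build R[i] H cscaleA cscale1 cscaleDr cscaleDl.

Definition real_vector (h : HR) : H := (h, 0).

(* Antilinear on the left, linear on the right. *)
Definition cdot (dot : {dot HR for idfun}) (u v : H) : R[i] :=
  ((dot u.1 v.1 + dot u.2 v.2) +i* (dot u.1 v.2 - dot u.2 v.1))%C.

Lemma cdot_linear dot u : linear (cdot dot u : H -> R[i]^o).
Proof.
move=> [a a'] v w; rewrite /cdot /=; apply/eqP; rewrite eq_complex /=.
rewrite !linearDr !linearNr !linearZr_LR /=.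
apply/andP; split; apply/eqP; ring.
Qed.

Lemma cdot_hermitian dot u v : cdot dot v u = (cdot dot u v)^*.
Proof.
have dotC a b : dot a b = dot b a by rewrite hermC /= expr0 mul1r.
rewrite -[RHS]/(conjc _) /cdot /=.
by rewrite (dotC v.1) (dotC v.2) (dotC v.1) (dotC v.2) opprB.
Qed.

End Complexification.

Section FockSpace.
Variables (C : numClosedFieldType) (V : lmodType C).

(* The word [:: (y_1, x_1); ...; (y_n, x_n)] encodes the elementary tensor
   y_n (x) ... (x) y_1 (x) x_1 (x) ... (x) x_n of V^{(x) n} (x) V^{(x) n}:
   the k-th pair holds the factors in positions -k and k. The empty word is
   the vacuum Omega (x) Omega. *)
Definition word := seq (V * V).

Definition multilinear (W : lmodType C) (G : word -> W) : Prop :=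
  forall (u v : word) (y : V),
    linear (fun x => G (u ++ (x, y) :: v)) /\
    linear (fun x => G (u ++ (y, x) :: v)).

Record mform := MForm {
  mform_fun :> word -> C^o;
  mform_multilinear : multilinear mform_fun }.

(* The algebraic direct sum over n of V^{(x) n} (x) V^{(x) n}: formal linear
   combinations of words, two of them being identified when every multilinear
   form takes the same value on both (over a field, this is the same as being
   congruent modulo the multilinearity relations). A tensor is thus
   represented by its values on all forms. *)
Definition tensorial : {pred mform -> C^o} := fun f =>
  `[< exists s : seq (C * word),
        f = (fun M => \sum_(cw <- s) cw.1 *: M cw.2) >].

Fact tensorial_submod : submod_closed tensorial.
Proof.
split=> [|a f g /asboolP[s ->] /asboolP[t ->]]; apply/asboolP.
  by exists [::]; apply/funext => M; rewrite big_nil.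
exists ([seq (a * cw.1, cw.2) | cw <- s] ++ t); apply/funext => M.
rewrite big_cat big_map /=; congr (_ + _).
rewrite [LHS]scaler_sumr; apply: eq_bigr => cw _.
by rewrite scalerA.
Qed.

HB.instance Definition _ := GRing.isSubmodClosed.Build C (mform -> C^o)
  tensorial tensorial_submod.

Record fock := Fock { fock_val :> mform -> C^o; _ : fock_val \in tensorial }.

HB.instance Definition _ := [isSub for fock_val].
HB.instance Definition _ := [Choice of fock by <:].
HB.instance Definition _ := [SubChoice_isSubLmodule of fock by <:].

Fact tens_subproof (w : word) : (fun M : mform => M w) \in tensorial.
Proof.
apply/asboolP; exists [:: (1, w)]; apply/funext => M.
by rewrite big_seq1 scale1r.
Qed.

Definition tens (w : word) : fock := Fock (tens_subproof w).

Definition vacuum : fock := tens [::].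

Fact expansion_subproof (f : fock) : exists s : seq (C * word),
  fock_val f = (fun M => \sum_(cw <- s) cw.1 *: M cw.2).
Proof. by case: f => f /= /asboolP. Qed.

Definition expansion (f : fock) : seq (C * word) :=
  projT1 (cid (expansion_subproof f)).

(* Linear extension to the Fock space of a multilinear map given on words;
   see lift_tens for the independence of the expansion. *)
Definition lift (W : lmodType C) (G : word -> W) (f : fock) : W :=
  \sum_(cw <- expansion f) cw.1 *: G cw.2.

Lemma fockP (f g : fock) : (forall M : mform, f M = g M) -> f = g.
Proof. by move=> fg; apply: val_inj; apply/funext. Qed.

Lemma expansionE (f : fock) (M : mform) :
  f M = \sum_(cw <- expansion f) cw.1 *: M cw.2.
Proof. by rewrite {1}(projT2 (cid (expansion_subproof f))). Qed.

Lemma fockDE (f g : fock) M : (f + g) M = f M + g M.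
Proof. by []. Qed.

Lemma fockZE a (f : fock) M : (a *: f) M = a *: f M.
Proof. by []. Qed.

Lemma fock_sumE I (r : seq I) (F : I -> fock) M :
  (\sum_(i <- r) F i) M = \sum_(i <- r) F i M.
Proof. by elim/big_rec2: _ => // i x y _ <-. Qed.

Lemma fock_expansion (f : fock) :
  f = \sum_(cw <- expansion f) cw.1 *: tens cw.2.
Proof. by apply: fockP => M; rewrite expansionE fock_sumE. Qed.

Lemma tens_multilinear : multilinear tens.
Proof.
by move=> u v y; split=> a x x'; apply: fockP => M;
  case: (mform_multilinear M u v y) => h1 h2; [exact: h1|exact: h2].
Qed.

Fact lift_form_subproof (G : word -> fock) (M : mform) :
  multilinear G -> multilinear ((fun w => G w M) : word -> C^o).
Proof.
by move=> Gm u v y; split=> a x x'; case: (Gm u v y) => h1 h2;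
  rewrite ?h1 ?h2 fockDE fockZE.
Qed.

Lemma liftE (G : word -> fock) (Gm : multilinear G) (f : fock) (M : mform) :
  lift G f M = f (MForm (lift_form_subproof M Gm)).
Proof. by rewrite fock_sumE expansionE. Qed.

Lemma lift_is_linear (G : word -> fock) : multilinear G -> linear (lift G).
Proof.
by move=> Gm a f g; apply: fockP => M; rewrite fockDE fockZE !(liftE Gm).
Qed.

Lemma lift_tens (G : word -> fock) w : multilinear G -> lift G (tens w) = G w.
Proof. by move=> Gm; apply: fockP => M; rewrite (liftE Gm). Qed.

Lemma lift_scalarE (M : mform) (f : fock) : lift M f = f M.
Proof. by rewrite expansionE. Qed.

End FockSpace.

Arguments vacuum {C V}.

(* The pair (i, true) stands for i + 1 and (i, false) for -(i + 1). *)
Definition signed (n : nat) : finType := ('I_n * bool)%type.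

Section Hyperoctahedral.
Variable n : nat.

Definition bar (p : signed n) : signed n := (p.1, ~~ p.2).

Definition hyperoctahedral : {set {perm signed n}} :=
  [set s : {perm signed n} | [forall p, s (bar p) == bar (s p)]].

(* pi_0 exchanges 1 and -1; pi_i exchanges i with i + 1 and -i with -(i + 1),
   that is, the ordinals i - 1 and i. *)
Definition generator (i : 'I_n) : {perm signed n} :=
  if val i == 0%N then tperm (i, true) (i, false)
  else (tperm (ord_pred i, true) (i, true) *
        tperm (ord_pred i, false) (i, false))%g.

Definition word_for (s : {perm signed n}) (w : seq 'I_n) : Prop :=
  s = (\prod_(i <- w) generator i)%g.

Definition reduced_word_for (s : {perm signed n}) (w : seq 'I_n) : Prop :=
  word_for s w /\ forall w', word_for s w' -> (size w <= size w')%N.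

Definition reduced_word (s : {perm signed n}) : seq 'I_n :=
  xget [::] [set w | reduced_word_for s w].

(* All reduced words of s have the same numbers of letters pi_0 and pi_i,
   i > 0, and reversing the order of composition does not change them. *)
Definition l1 (s : {perm signed n}) : nat :=
  count (fun i : 'I_n => val i == 0%N) (reduced_word s).
Definition l2 (s : {perm signed n}) : nat :=
  count (fun i : 'I_n => val i != 0%N) (reduced_word s).

End Hyperoctahedral.

Section Operators.
Variables (C : numClosedFieldType) (V : lmodType C).
Variables (ip : V -> V -> C) (alpha q : C).
Local Notation word := (word V).
Local Notation fock := (fock V).

Definition del (k : nat) (w : word) : word := take k w ++ drop k.+1 w.
Definition lpart (w : word) (k : nat) : V := (nth (0, 0) w k).1.
Definition rpart (w : word) (k : nat) : V := (nth (0, 0) w k).2.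

Lemma del_cat_lt k (u v : word) p : (k < size u)%N ->
  del k (u ++ p :: v) = del k u ++ p :: v.
Proof.
move=> ku; rewrite /del take_cat ku drop_cat -catA.
case: (ltngtP k.+1 (size u)) => [//||E]; first by rewrite ltnNge ku.
by rewrite E subnn drop0 drop_size.
Qed.

Lemma del_cat_eq (u v : word) p : del (size u) (u ++ p :: v) = u ++ v.
Proof.
by rewrite /del take_size_cat // -cat_rcons drop_size_cat ?size_rcons.
Qed.

Lemma del_cat_gt k (u v : word) p : (size u < k)%N ->
  del k (u ++ p :: v) = u ++ p :: del (k - (size u).+1) v.
Proof.
move=> uk; rewrite /del -cat_rcons take_cat drop_cat size_rcons.
by rewrite !ltnS leqNgt uk ltnNge (ltnW uk) /= subSn // cat_rcons -catA.
Qed.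

Fact multilinear_del (W : lmodType C) (c : nat -> nat -> C)
  (F : V * V -> word -> W) :
  (forall p, multilinear (F p)) ->
  (forall r y, linear (fun x => F (x, y) r) /\ linear (fun x => F (y, x) r)) ->
  multilinear (fun w => \sum_(k < size w)
                          c (size w) k *: F (nth (0, 0) w k) (del k w)).
Proof.
move=> Fm Fl.
suff main (u v : word) (f : V -> V * V) :
    (forall p u v, linear (fun x => F p (u ++ f x :: v))) ->
    (forall r, linear (fun x => F (f x) r)) ->
    linear (fun x => \sum_(k < size (u ++ f x :: v)) c (size (u ++ f x :: v)) k
              *: F (nth (0, 0) (u ++ f x :: v) k) (del k (u ++ f x :: v))).
  by move=> u v y; split; apply: main => [p u' v'|r];
    [exact: (Fm p u' v' y).1|exact: (Fl r y).1
    |exact: (Fm p u' v' y).2|exact: (Fl r y).2].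
move=> Fm' Fl' a x x'; rewrite /= !size_cat /= scaler_sumr -big_split /=.
apply: eq_bigr => k _; rewrite scalerA mulrC -scalerA -scalerDr; congr (_ *: _).
rewrite !nth_cat; case: ltngtP => ku.
- by rewrite !del_cat_lt // Fm'.
- by rewrite !del_cat_gt // -(subnSK ku) /= Fm'.
- by rewrite ku subnn /= !del_cat_eq Fl'.
Qed.

(* Positions are counted from 0 here: position k is the factor k + 1 of the
   usual formulas. The annihilation formula is the one of the adjoint of
   [creation x y] for [deformed_ip] below, when x and y are real vectors. *)
Definition creation_word (x y : V) (w : word) : fock := tens (rcons w (x, y)).

Definition annihilation_word (x y : V) (w : word) : fock :=
  let n := size w in
  \sum_(k < n) q ^+ (n - k.+1) *:
    ((ip x (lpart w k) * ip y (rpart w k)) *: tens (del k w)) +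
  (alpha * q ^+ n.-1) *: \sum_(k < n) q ^+ k *:
    ((ip x (rpart w k) * ip y (lpart w k)) *: tens (del k w)).

Definition gauge_word (T' T : V -> V) (w : word) : fock :=
  let n := size w in
  \sum_(k < n) q ^+ (n - k.+1) *:
    tens (rcons (del k w) (T' (lpart w k), T (rpart w k))) +
  (alpha * q ^+ n.-1) *: \sum_(k < n) q ^+ k *:
    tens (rcons (del k w) (T' (rpart w k), T (lpart w k))).

Definition creation (x y : V) : fock -> fock := lift (creation_word x y).
Definition annihilation (x y : V) : fock -> fock :=
  lift (annihilation_word x y).
Definition gauge (T' T : V -> V) : fock -> fock := lift (gauge_word T' T).

Definition double_poisson (x' x : V) (T' T : V -> V) (l' l : C)
  (f : fock) : fock :=
  annihilation x' x f + creation x' x f + gauge T' T f + (l' * l) *: f.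

Hypothesis ip_linear : forall u, linear (ip u : V -> C^o).

Lemma creation_word_multilinear x y : multilinear (creation_word x y).
Proof.
move=> u v z; split=> a t t'; rewrite /creation_word !rcons_cat !rcons_cons.
  exact: (tens_multilinear u (rcons v (x, y)) z).1.
exact: (tens_multilinear u (rcons v (x, y)) z).2.
Qed.

Lemma creation_tens x y w : creation x y (tens w) = tens (rcons w (x, y)).
Proof. exact/lift_tens/creation_word_multilinear. Qed.

Fact multilinear_del2 (F : V * V -> word -> fock) :
  (forall p, multilinear (F p)) ->
  (forall r y, linear (fun x => F (x, y) r) /\ linear (fun x => F (y, x) r)) ->
  multilinear (fun w =>
    \sum_(k < size w) q ^+ (size w - k.+1) *:
      F (lpart w k, rpart w k) (del k w) +
    (alpha * q ^+ (size w).-1) *: \sum_(k < size w) q ^+ k *: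
      F (rpart w k, lpart w k) (del k w)).
Proof.
move=> Fm Fl.
have m1 := multilinear_del (fun n k => q ^+ (n - k.+1)) Fm Fl.
have Fm' p : multilinear (F (p.2, p.1)) by [].
have Fl' r y : linear (fun x => F (y, x) r) /\ linear (fun x => F (x, y) r).
  by case: (Fl r y).
have m2 := @multilinear_del _ (fun n k => alpha * q ^+ n.-1 * q ^+ k)
  (fun p => F (p.2, p.1)) Fm' Fl'.
pose G (w : word) : fock :=
  \sum_(k < size w) q ^+ (size w - k.+1) *: F (nth (0, 0) w k) (del k w) +
  \sum_(k < size w) (alpha * q ^+ (size w).-1 * q ^+ k) *:
    F ((nth (0, 0) w k).2, (nth (0, 0) w k).1) (del k w).
have Gm : multilinear G.
  move=> u v y; case: (m1 u v y) => l1 r1; case: (m2 u v y) => l2 r2.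
  by split=> a x x'; rewrite /G ?(l1, r1) ?(l2, r2) scalerDr addrACA.
congr (multilinear _): Gm; apply/funext => w; congr (_ + _).
  by apply: eq_bigr => k _; rewrite /lpart /rpart -surjective_pairing.
by rewrite scaler_sumr; apply: eq_bigr => k _; rewrite scalerA.
Qed.

Lemma annihilation_word_multilinear x y : multilinear (annihilation_word x y).
Proof.
apply: (@multilinear_del2
  (fun p w => (ip x p.1 * ip y p.2) *: tens w)) => [p u v z|r z].
  by case: (tens_multilinear u v z) => h1 h2; split=> a t t';
    rewrite ?h1 ?h2 scalerDr !scalerA mulrC.
split=> a t t' /=; rewrite ip_linear.
  by rewrite mulrDl scalerDl scalerA -mulrA.
by rewrite mulrDr scalerDl scalerA mulrCA.
Qed.

Lemma annihilation_tens x y w :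
  annihilation x y (tens w) = annihilation_word x y w.
Proof. exact/lift_tens/annihilation_word_multilinear. Qed.

Lemma gauge_word_multilinear (T' T : {linear V -> V}) :
  multilinear (gauge_word T' T).
Proof.
apply: (@multilinear_del2
  (fun p w => tens (rcons w (T' p.1, T p.2)))) => [p u v z|r z].
  split=> a t t'; rewrite !rcons_cat !rcons_cons.
    exact: (tens_multilinear u (rcons v (T' p.1, T p.2)) z).1.
  exact: (tens_multilinear u (rcons v (T' p.1, T p.2)) z).2.
split=> a t t' /=; rewrite linearP -!cats1.
  exact: (tens_multilinear r [::] (T z)).1.
exact: (tens_multilinear r [::] (T' z)).2.
Qed.

Lemma gauge_tens (T' T : {linear V -> V}) w :
  gauge T' T (tens w) = gauge_word T' T w.
Proof. exact/lift_tens/gauge_word_multilinear. Qed.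

Definition factor (n : nat) (w : word) (p : signed n) : V :=
  if p.2 then rpart w p.1 else lpart w p.1.

Definition word_perm (n : nat) (s : {perm signed n}) (w : word) : word :=
  [seq (factor w ((s^-1)%g (k, false)), factor w ((s^-1)%g (k, true)))
     | k <- enum 'I_n].

(* P^(n) on words of length n; words of different lengths are orthogonal. *)
Definition symmetrizer_word (n : nat) (w : word) : fock :=
  \sum_(s in hyperoctahedral n)
    (alpha ^+ l1 s * q ^+ l2 s) *: tens (word_perm s w).

Definition symmetrizer : fock -> fock :=
  lift (fun w => symmetrizer_word (size w) w).

Definition ip_word (u v : word) : C :=
  if size u == size v then
    \prod_(p <- zip u v) (ip p.1.1 p.2.1 * ip p.1.2 p.2.2)
  else 0.

Definition free_ip (f g : fock) : C :=
  \sum_(cu <- expansion f) \sum_(dv <- expansion g)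
    cu.1^* * dv.1 * ip_word cu.2 dv.2.

Definition deformed_ip (f g : fock) : C := free_ip f (symmetrizer g).

Definition vacuum_state (A : fock -> fock) : C :=
  deformed_ip vacuum (A vacuum).

Fact act_linear (u v : word) (f : V -> V * V) (b : bool)
    (s : {perm signed (size u + (size v).+1)}) :
  (forall x, (if b then (f x).2 else (f x).1) = x) ->
  (forall x x', (if b then (f x).1 else (f x).2) =
                (if b then (f x').1 else (f x').2)) ->
  linear (fun x => tens (word_perm s (u ++ f x :: v)) : fock).
Proof.
move=> fb fNb; set n := (size u + (size v).+1)%N in s *.
have un : (size u < n)%N by rewrite /n addnS ltnS leq_addr.
pose k0 : 'I_n := Ordinal un; pose r0 : signed n := (k0, b).
have fact_r0 x : factor (u ++ f x :: v) r0 = x.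
  by rewrite /factor /rpart /lpart /= nth_cat ltnn subnn /= fb.
have fact_r r x x' : r != r0 ->
    factor (u ++ f x :: v) r = factor (u ++ f x' :: v) r.
  case: r => k c rk; rewrite /factor /rpart /lpart /= !nth_cat.
  case: ltngtP => // ku; first by rewrite -(subnSK ku).
  have {}rk : c != b.
    by apply: contraNneq rk => ->; apply/eqP; congr pair; exact: val_inj.
  rewrite ku subnn /=; have := fNb x x'.
  by case: (c) (b) rk => [] [].
pose g x (k : 'I_n) := (factor (u ++ f x :: v) ((s^-1)%g (k, false)),
                        factor (u ++ f x :: v) ((s^-1)%g (k, true))).
have gE x x' k : k != (s r0).1 -> g x k = g x' k.
  move=> ks; rewrite /g; congr pair; apply: fact_r; apply: contra ks => /eqP <-;
  by rewrite permKV.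
have [e1 [e2 [enE k1 k2]]] : exists e1 e2, [/\ enum 'I_n = e1 ++ (s r0).1 :: e2,
    (s r0).1 \notin e1 & (s r0).1 \notin e2].
  have := enum_uniq 'I_n; case/splitPr: (mem_enum 'I_n (s r0).1) => e1 e2.
  rewrite cat_uniq /= => /and4P[_ + + _]; rewrite negb_or => /andP[k1 _] k2.
  by exists e1, e2.
have actE x : word_perm s (u ++ f x :: v) =
    map (g 0) e1 ++ g x (s r0).1 :: map (g 0) e2.
  rewrite /word_perm enE map_cat /=; congr (_ ++ _ :: _).
    by apply/eq_in_map => k ke; apply: gE; apply: contraNneq k1 => <-.
  by apply/eq_in_map => k ke; apply: gE; apply: contraNneq k2 => <-.
have [y gy] : exists y, forall x,
    g x (s r0).1 = if (s r0).2 then (y, x) else (x, y).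
  exists (factor (u ++ f 0 :: v) ((s^-1)%g ((s r0).1, ~~ (s r0).2))) => x.
  have sr : s^-1%g ((s r0).1, (s r0).2) = r0.
    by rewrite -surjective_pairing permK.
  have srN : s^-1%g ((s r0).1, ~~ (s r0).2) != r0.
    by rewrite -[X in _ != X]sr (inj_eq perm_inj) xpair_eqE eqxx;
      case: (s r0).2.
  rewrite /g; case: (s r0).2 sr srN => /= sr srN.
    by rewrite sr fact_r0; congr pair; exact: fact_r.
  by rewrite sr fact_r0; congr pair; exact: fact_r.
have [l1 l2] := tens_multilinear (map (g 0) e1) (map (g 0) e2) y.
by move=> a x x'; rewrite !actE !gy; case: (s r0).2; [exact: l2|exact: l1].
Qed.

Lemma symmetrizer_word_multilinear :
  multilinear (fun w => symmetrizer_word (size w) w).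
Proof.
suff main (u v : word) (f : V -> V * V) (b : bool) :
    (forall x, (if b then (f x).2 else (f x).1) = x) ->
    (forall x x', (if b then (f x).1 else (f x).2) =
                  (if b then (f x').1 else (f x').2)) ->
    linear (fun x => symmetrizer_word (size (u ++ f x :: v)) (u ++ f x :: v)).
  by move=> u v y; split; [apply: (main _ _ _ false)|apply: (main _ _ _ true)].
move=> fb fNb a x x' /=; rewrite !size_cat /= /symmetrizer_word scaler_sumr.
rewrite -big_split; apply: eq_bigr => s _ /=.
by rewrite (act_linear s fb fNb) scalerDr !scalerA mulrC.
Qed.

Lemma symmetrizer_tens w :
  symmetrizer (tens w) = symmetrizer_word (size w) w.
Proof. exact: (lift_tens _ symmetrizer_word_multilinear). Qed.

Hypothesis ip_hermitian : forall u v, ip v u = (ip u v)^*.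

Fact ip_word_multilinear (u : word) : multilinear (ip_word u : word -> C^o).
Proof.
suff main (v1 v2 : word) (f : V -> V * V) :
    (forall p : V * V,
       linear (fun x => ip p.1 (f x).1 * ip p.2 (f x).2 : C^o)) ->
    linear (fun x => ip_word u (v1 ++ f x :: v2) : C^o).
  move=> v1 v2 y; split; apply: main => p a x x' /=; rewrite ip_linear.
    by rewrite [LHS]mulrDl -mulrA.
  by rewrite [LHS]mulrDr mulrCA.
move=> fl a x x'; rewrite /ip_word !size_cat /=.
case: eqP => [us|_]; last by rewrite scaler0 addr0.
have v1u : (size v1 < size u)%N by rewrite us addnS ltnS leq_addr.
have su : size (take (size v1) u) = size v1 by rewrite size_take v1u.
rewrite -(cat_take_drop (size v1) u) (drop_nth (0, 0)) // !zip_cat //=.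
rewrite !big_cat !big_cons /= fl mulrDl mulrDr; congr (_ + _).
by rewrite -[(a *: _) * _]mulrA [LHS]mulrCA.
Qed.

Lemma free_ip_linear f : linear (free_ip f : fock -> C^o).
Proof.
have E g : free_ip f g = \sum_(cu <- expansion f)
    cu.1^* * fock_val g (MForm (@ip_word_multilinear cu.2)).
  rewrite /free_ip; apply: eq_bigr => cu _; rewrite expansionE mulr_sumr.
  by apply: eq_bigr => dv _ /=; rewrite mulrA.
move=> a g h; rewrite !E scaler_sumr -big_split; apply: eq_bigr => cu _.
by rewrite fockDE fockZE mulrDr [_ * (a *: _)]mulrCA.
Qed.

Lemma free_ip_tens u v : free_ip (tens u) (tens v) = ip_word u v.
Proof.
have ip_wordC u' v' : ip_word v' u' = (ip_word u' v')^*.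
  rewrite /ip_word eq_sym; case: eqP => uv; last by rewrite rmorph0.
  elim: u' v' uv => [|p u' IH] [|r v'] //= uv.
    by rewrite !big_nil rmorph1.
  by case: uv => uv; rewrite !big_cons IH // !rmorphM /= -!ip_hermitian.
have E cu : \sum_(dv <- expansion (tens v)) cu.1^* * dv.1 * ip_word cu.2 dv.2 =
    (cu.1 * ip_word v cu.2)^*.
  rewrite rmorphM /= -ip_wordC.
  have := expansionE (tens v) (MForm (@ip_word_multilinear cu.2)) => /= ->.
  by rewrite mulr_sumr; apply: eq_bigr => dv _; rewrite -mulrA.
rewrite /free_ip (eq_bigr _ (fun cu _ => E cu)) -rmorph_sum /= ip_wordC.
by have := expansionE (tens u) (MForm (@ip_word_multilinear v)) => /= ->.
Qed.

End Operators.

Section Partitions.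
Variable n : nat.
Local Notation signed := (signed n).

Definition signed_int (p : signed) : int :=
  if p.2 then (p.1.+1)%:Z else - (p.1.+1)%:Z.

Definition typeB_partition (pi : {set {set signed}}) : bool :=
  [&& finset.partition pi [set: signed],
      [forall V in pi, (@bar n @: V) \in pi] &
      [forall V in pi, @bar n @: V != V]].

(* A B-block (V', V) is represented by its second component V, the block
   whose element of largest absolute value is positive. *)
Definition positive_block (V : {set signed}) : bool :=
  [exists p in V, p.2 && [forall r in V, (r.1 <= p.1)%N]].

Definition Bblocks (pi : {set {set signed}}) : {set {set signed}} :=
  [set V in pi | positive_block V].

(* [:: i_1; ...; i_m], by increasing absolute value. *)
Definition block_seq (V : {set signed}) : seq signed :=
  sort (fun p r : signed => (p.1 <= r.1)%N) (enum V).

(* The B-arc made of (i_j, i_(j+1)) and its reflection is represented by the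
   pair (i_j, i_(j+1)), taken in the positive block. *)
Definition Barcs (pi : {set {set signed}}) : {set signed * signed} :=
  [set a | [exists V in Bblocks pi,
              a \in zip (block_seq V) (behead (block_seq V))]].

Definition negative_arc (a : signed * signed) : bool := a.1.2 != a.2.2.

Definition Na (pi : {set {set signed}}) : nat :=
  #|[set a in Barcs pi | negative_arc a]|.

Definition bar_arc (a : signed * signed) : signed * signed :=
  (bar a.1, bar a.2).

Definition arc_min (a : signed * signed) : int :=
  Num.min (signed_int a.1) (signed_int a.2).
Definition arc_max (a : signed * signed) : int :=
  Num.max (signed_int a.1) (signed_int a.2).

Definition crosses (a b : signed * signed) : bool :=
  (arc_min a < arc_min b < arc_max a) && (arc_max a < arc_max b) ||
  (arc_min b < arc_min a < arc_max b) && (arc_max b < arc_max a).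

(* The condition on ranks selects each unordered pair of distinct B-arcs
   once; the summand does not depend on the order of the pair. *)
Definition Rc (pi : {set {set signed}}) : nat :=
  (\sum_(a in Barcs pi)
    \sum_(b in Barcs pi | (enum_rank a < enum_rank b)%N)
      (crosses a b + crosses (bar_arc a) b))%N.

End Partitions.

Section Cumulants.
Variables (C : numClosedFieldType) (V : lmodType C) (ip : V -> V -> C).
Variables (n : nat) (x : signed n -> V) (T : signed n -> V -> V).
Variable lam : signed n -> C.

(* <x_{i_m}, T_{i_(m-1)} ... T_{i_2} x_{i_1}> for s = [:: i_2; ...; i_m]. *)
Definition moment (i1 : signed n) (s : seq (signed n)) : C :=
  ip (x (last i1 s)) (foldl (fun v i => T i v) (x i1) (behead (belast i1 s))).

Definition block_cumulant (B : {set signed n}) : C :=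
  match block_seq B with
  | [::] => 1
  | [:: i] => lam (bar i) * lam i
  | i :: s => moment (bar i) (map (@bar n) s) * moment i s
  end.

Definition partition_cumulant (pi : {set {set signed n}}) : C :=
  \prod_(B in Bblocks pi) block_cumulant B.

End Cumulants.

(* Main.v *)
(* A type B partition is recorded by its links: each k in {1,...,n} that is not
   the least point (in absolute value) of its block points to the preceding
   point j of the block of +k, with the sign change of the arc joining them.
   Type B partitions thus correspond to the maps k |-> (j, sign) with j < k
   in which no j is used twice. For such a map each of Na, Rc and the cumulants
   is a sum or product over k: an arc ending at k, started at j, is crossed by
   the later arcs that start at a point t < k, once if t > j, and twice or never
   if t < j, according to whether the arc is negative or not.

   On the operator side, the factors of a word in the Fock space, from the
   inside out, are the points still open, in increasing order. Applying the
   operator number k decides the link of k (gauge or annihilation on the factor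
   of j, straight or crossed; creation or scalar if there is none) and whether k
   stays open, and the powers of q count the factors outside and inside that of
   j exactly as above. The theorem follows by fixing the links of the points
   below m and descending on m. *)
Require Import Defs.
From mathcomp Require Import all_boot all_order all_algebra all_fingroup.
From mathcomp Require Import all_classical all_reals topology normedtype.
From mathcomp Require Import sesquilinear complex.
From mathcomp Require Import zify ring.
Import Order.TTheory GRing.Theory Num.Theory numFieldNormedType.Exports.
Local Open Scope ring_scope.

Set Implicit Arguments.
Unset Strict Implicit.
Unset Printing Implicit Defensive.

(** * Links of a type B partition *)

(* [f k = Some (j, b)]: the B-arc ending at [k] starts at [j], and [b] tells
   whether it is negative; [f k = None]: [k] is the first point of its block. *)
Notation links n := {ffun 'I_n -> option ('I_n * bool)}.

Section Links.
Local Open Scope nat_scope.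
Variable n : nat.
Implicit Types (p r z : signed n) (i j k : 'I_n).
Implicit Type f : links n.

Definition source f i j : bool := if f i is Some l then l.1 == j else false.

Definition linking f : bool :=
  [forall i, forall j, source f i j ==> (j < i)] &&
  [forall i, forall k, forall j, source f i j && source f k j ==> (i == k)].

Lemma linkingP f : reflect
  ((forall i j, source f i j -> j < i) /\
   (forall i k j, source f i j -> source f k j -> i = k)) (linking f).
Proof.
apply: (iffP andP) => -[h1 h2]; split.
- by move=> i j; move/forallP/(_ i)/forallP/(_ j)/implyP: h1.
- move=> i k j h h'.
  move/forallP/(_ i)/forallP/(_ k)/forallP/(_ j)/implyP: h2 => h2.
  by apply/eqP/h2; rewrite h h'.
- by apply/forallP => i; apply/forallP => j; apply/implyP/h1.
- apply/forallP => i; apply/forallP => k; apply/forallP => j.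
  by apply/implyP => /andP[h h']; rewrite (h2 _ _ _ h h').
Qed.

Lemma barK : involutive (@bar n).
Proof. by case=> i s; rewrite /bar /= negbK. Qed.

Lemma bar_neq p : bar p != p.
Proof. by case: p => i s; rewrite /bar xpair_eqE eqxx /=; case: s. Qed.

Lemma abs_eq p r : p.1 = r.1 -> p = r \/ p = bar r.
Proof.
case: p r => i s [k t] /= ->; case: s t => -[]; rewrite /bar /=; by [left|right].
Qed.

(** Links live on absolute values; the sign of [p] is carried along, so the map commutes with [bar].
    First points of blocks are fixed, so its iterates stabilise. *)
Definition link_step f p : signed n := if f p.1 is Some l then (l.1, l.2 (+) p.2) else p.

Lemma step_bar f p : link_step f (bar p) = bar (link_step f p).
Proof. by rewrite /link_step /bar /=; case: (f p.1) => [[j b]|] //=; rewrite addbN. Qed.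

(** For a linking, [n] steps always reach the first point of the block, since every effective step
    lowers the absolute value. *)
Definition link_root f p : signed n := iter n (link_step f) p.

Lemma root_bar f p : link_root f (bar p) = bar (link_root f p).
Proof.
have main m : iter m (link_step f) (bar p) = bar (iter m (link_step f) p).
  by elim: m => //= m ->; rewrite step_bar.
exact: main.
Qed.

Lemma step_None f p : f p.1 = None -> link_step f p = p.
Proof. by rewrite /link_step => ->. Qed.

Lemma root_None f p : f p.1 = None -> link_root f p = p.
Proof. by move=> fp; rewrite /link_root iter_fix // step_None. Qed.

Lemma source_step f p : f p.1 != None -> source f p.1 (link_step f p).1.
Proof. by rewrite /source /link_step; case: (f p.1) => [[j b]|]. Qed.

(** * Roots of a linking *)

Section Linking.
Variable f : links n.
Hypothesis ff : linking f.

Lemma source_lt i j : source f i j -> j < i.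
Proof. by have /linkingP[+ _] := ff; apply. Qed.

Lemma source_inj i k j : source f i j -> source f k j -> i = k.
Proof. by have /linkingP[_ +] := ff; apply. Qed.

Lemma step_lt p : f p.1 != None -> (link_step f p).1 < p.1.
Proof. by move=> fp; exact/source_lt/source_step. Qed.

Lemma root_end p : f (link_root f p).1 = None.
Proof.
(* Either a first point has been reached, or [m] steps have lowered the absolute value by at least
   [m]. *)
have main m : f (iter m (link_step f) p).1 = None \/ (iter m (link_step f) p).1 + m <= p.1.
  elim: m => [|m [IH|IH]]; first by right; rewrite addn0.
    by left; rewrite /= step_None.
  case E: (f (iter m (link_step f) p).1) => [l|]; last by left; rewrite /= step_None.
  by right; rewrite /= addnS -addSn; apply: leq_trans IH; rewrite leq_add2r
    step_lt ?E.
by case: (main n) => // h; have := ltn_ord p.1; rewrite ltnNge (leq_trans _ h) // leq_addl.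
Qed.

Lemma root_step p : link_root f (link_step f p) = link_root f p.
Proof. by rewrite /link_root -iterSr /= step_None // root_end. Qed.

Lemma root_le p : (link_root f p).1 <= p.1.
Proof.
suff main m : (iter m (link_step f) p).1 <= p.1 by exact: main.
elim: m => //= m IH; apply: leq_trans IH.
case E: (f (iter m (link_step f) p).1) => [l|]; last by rewrite step_None.
by apply/ltnW/step_lt; rewrite E.
Qed.

(** Otherwise [p = bar r], and the common root would be its own reflection. *)
Lemma root_abs_inj p r : link_root f p = link_root f r -> p.1 = r.1 -> p = r.
Proof.
move=> + /abs_eq[//|pr]; rewrite pr root_bar => /eqP.
by rewrite (negPf (bar_neq _)).
Qed.

(* If [r] were linked to a point strictly below [p], that point would also, by
   induction, be a source for some point not beyond [p], against injectivity. *)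
Lemma root_source p r : link_root f p = link_root f r -> p.1 < r.1 ->
  exists2 i, source f i p.1 & i <= r.1.
Proof.
move: {2}(p.1 + r.1).+1 (ltnSn (p.1 + r.1)) => m.
elim: m p r => // m IH p r; rewrite ltnS => hm pr lt_pr.
have fr : f r.1 != None.
  apply: contraTneq lt_pr => fr; rewrite -leqNgt.
  by rewrite -[r](root_None fr) -pr root_le.
have lt_r := step_lt fr; have s_r := source_step fr.
case: (ltngtP p.1 (link_step f r).1) => [h|h|h].
- have [|||i i1 i2] := IH p (link_step f r); rewrite ?root_step //.
    by apply: leq_trans hm; rewrite ltn_add2l.
  by exists i => //; apply: leq_trans i2 (ltnW lt_r).
- have [|||i i1 i2] := IH (link_step f r) p; rewrite ?root_step //.
    by rewrite addnC; apply: leq_trans hm; rewrite ltn_add2l.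
  by move: lt_pr; rewrite -(source_inj i1 s_r) ltnNge i2.
- by exists r.1 => //; have -> : p.1 = (link_step f r).1 by exact: val_inj.
Qed.

End Linking.

Definition link_part f : {set {set signed n}} := preim_partition (link_root f) [set: signed n].

Lemma mem_part f p r : (r \in finset.pblock (link_part f) p) = (link_root f p == link_root f r).
Proof.
apply: pblock_equivalence_partition; rewrite ?inE // => x y z _ _ _.
by split=> // /eqP->.
Qed.

Lemma link_partP f : finset.partition (link_part f) [set: signed n].
Proof. exact: preim_partitionP. Qed.

(** * From a type B partition to its links *)

Section TypeB.
Variable pi : {set {set signed n}}.
Hypothesis piB : typeB_partition pi.

Local Notation blk := (finset.pblock pi).

Lemma typeB_trivIset : finset.trivIset pi.
Proof. by case/and3P: piB => /and3P[]. Qed.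

Lemma typeB_cover p : p \in finset.cover pi.
Proof. by case/and3P: piB => /and3P[/eqP-> _ _] _ _; rewrite inE. Qed.

Lemma blk_in p : blk p \in pi.
Proof. exact/pblock_mem/typeB_cover. Qed.

Lemma mem_blk p : p \in blk p.
Proof. by rewrite mem_pblock typeB_cover. Qed.

Lemma eq_blk p r : (blk p == blk r) = (r \in blk p).
Proof. exact/eq_pblock/typeB_cover/typeB_trivIset. Qed.

Lemma blk_eq p r : r \in blk p -> blk r = blk p.
Proof. by move=> ?; apply/esym/eqP; rewrite eq_blk. Qed.

Lemma blk_sym p r : (r \in blk p) = (p \in blk r).
Proof. by rewrite -!eq_blk eq_sym. Qed.

Lemma def_blk V p : V \in pi -> p \in V -> blk p = V.
Proof. exact/def_pblock/typeB_trivIset. Qed.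

Lemma blk_bar p : blk (bar p) = @bar n @: blk p.
Proof.
case/and3P: piB => _ /forall_inP h _.
by apply: def_blk; [exact/h/blk_in|exact/imset_f/mem_blk].
Qed.

Lemma mem_blk_bar p r : (bar r \in blk (bar p)) = (r \in blk p).
Proof. by rewrite blk_bar mem_imset //; exact/inv_inj/barK. Qed.

(** If it were there, the block of [p] would meet its reflection, hence equal it. *)
Lemma bar_notin p r : r \in blk p -> bar r \notin blk p.
Proof.
move=> rp; apply/negP => brp; have h : bar r \in blk (bar p) by rewrite mem_blk_bar.
case/and3P: piB => _ _ /forall_inP/(_ _ (blk_in p)).
by rewrite -blk_bar -(blk_eq h) (blk_eq brp) eqxx.
Qed.

Lemma blk_abs_inj p r z : r \in blk p -> z \in blk p -> r.1 = z.1 -> r = z.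
Proof.
by move=> rp zp /abs_eq[//|E]; move: (bar_notin zp); rewrite -E rp.
Qed.

Definition block_prev p r : bool :=
  [&& p \in blk r, p.1 < r.1 & [forall z in blk r, (z.1 < r.1) ==> (z.1 <= p.1)]].

Lemma block_prevP p r : reflect [/\ p \in blk r, p.1 < r.1 &
   forall z, z \in blk r -> z.1 < r.1 -> z.1 <= p.1] (block_prev p r).
Proof.
apply: (iffP and3P) => -[h1 h2 h3]; split=> //.
  by move=> z zr; move/forall_inP/(_ z zr)/implyP: h3.
by apply/forall_inP => z zr; apply/implyP/h3.
Qed.

Lemma prev_bar p r : block_prev (bar p) (bar r) = block_prev p r.
Proof.
have main p' r' : block_prev p' r' -> block_prev (bar p') (bar r').
  move=> /block_prevP[h1 h2 h3]; apply/block_prevP; split; rewrite ?mem_blk_bar // => z.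
  by rewrite -[z]barK mem_blk_bar; exact: h3.
by apply/idP/idP => /main //; rewrite !barK.
Qed.

Lemma prev_uniq p z r : block_prev p r -> block_prev z r -> p = z.
Proof.
move=> /block_prevP[p1 p2 p3] /block_prevP[z1 z2 z3]; apply: (blk_abs_inj p1 z1).
by apply/val_inj/eqP; rewrite eqn_leq z3 ?p3.
Qed.

Lemma prev_ex p r : p \in blk r -> p.1 < r.1 -> exists z, block_prev z r.
Proof.
move=> pr ltpr.
have Pp : (p \in blk r) && (p.1 < r.1) by rewrite pr.
case: (@arg_maxnP _ p (fun z => (z \in blk r) && (z.1 < r.1)) (fun z => z.1) Pp)
  => /= z /andP[h1 h2] h3.
by exists z; apply/block_prevP; split=> // w w1 w2; apply: h3; rewrite w1.
Qed.

(** The link is read at the point [+i], so the arc is negative exactly when its start [p] is: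
    [~~ p.2] is [p.2 (+) true]. *)
Definition unlink : links n :=
  [ffun i => if [pick p | block_prev p (i, true)] is Some p then Some (p.1, ~~ p.2)
             else None].

(** Reflection invariance of the partition transfers the definition at [+i] to both signs. *)
Lemma unlinkE p r : (unlink r.1 == Some (p.1, p.2 (+) r.2)) = block_prev p r.
Proof.
wlog rT : p r / r.2.
  move=> h; case E: r.2; first by rewrite -E h.
  by rewrite -prev_bar -h /bar /= ?E //= addbF addbT negbK.
case: r rT => i [] //= _; rewrite addbT ffunE; case: pickP => [z zP|h]; last first.
  by rewrite h.
apply/eqP/idP => [[e1 /negb_inj e2]|/(prev_uniq zP) -> //].
by move: zP; rewrite (surjective_pairing z) e1 e2 -surjective_pairing.
Qed.

Lemma unlink_None r : unlink r.1 = None -> forall p, p \in blk r -> r.1 <= p.1.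
Proof.
move=> h p pr; rewrite leqNgt; apply/negP => /(prev_ex pr)[z].
by rewrite -unlinkE h.
Qed.

Lemma unlink_source i j s : source unlink i j -> exists t, block_prev (j, t) (i, s).
Proof.
rewrite /source; case E: (unlink i) => [[k b]|] //= /eqP <-.
by exists (b (+) s); rewrite -unlinkE /= E addbK.
Qed.

Lemma unlink_linking : linking unlink.
Proof.
apply/linkingP; split=> [i j|i k j si sk].
  by case/(unlink_source true) => t /block_prevP[].
wlog ik : i k si sk / i < k.
  move=> h; case: (ltngtP i k) => [||/val_inj//]; first exact: h.
  by move/(h k i sk si).
have [t /block_prevP[t1 t2 _]] := unlink_source true si.
have [u /block_prevP[u1 _ u3]] := unlink_source true sk.
(* If [i < k] had the same source [j], then [i], with the sign making its predecessor [(j, u)],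
   would lie in the block of [+k] strictly between [j] and [k]. *)
have ikb : (i, u == t) \in blk (k, true).
  rewrite -(blk_eq u1) blk_sym; case: eqVneq => [->//|ut].
  rewrite -[(i, false)]/(bar (i, true)).
  have -> : (j, u) = bar (j, t) by rewrite /bar /=; clear -ut; case: u t ut => -[].
  by rewrite mem_blk_bar.
by move: (u3 _ ikb ik) t2; rewrite /= leqNgt => /negPf->.
Qed.

Lemma root_unlink_mem p : link_root unlink p \in blk p.
Proof.
suff main m : iter m (link_step unlink) p \in blk p by exact: main.
elim: m => [|m IH] /=; first exact: mem_blk.
rewrite -(blk_eq IH); set z := iter _ _ _.
case E: (unlink z.1) => [[j b]|]; last by rewrite step_None // mem_blk.
rewrite /link_step E /=.
have : block_prev (j, b (+) z.2) z by rewrite -unlinkE E /= addbK.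
by case/block_prevP.
Qed.

Lemma unlinkK : link_part unlink = pi.
Proof.
rewrite /link_part /preim_partition.
case/and3P: (piB) => piP _ _; rewrite -[RHS](equivalence_partition_pblock piP).
apply: eq_imset => p; apply/setP => r; rewrite !inE /=.
apply/eqP/idP => [E|rp].
  by rewrite -eq_blk -(blk_eq (root_unlink_mem p)) E (blk_eq (root_unlink_mem r)).
have rr := root_unlink_mem r; rewrite (blk_eq rp) in rr.
have pp := root_unlink_mem p.
apply: (blk_abs_inj pp rr); apply/val_inj/eqP; rewrite eqn_leq.
(* Both roots are points of least absolute value in the same block. *)
have e z : unlink (link_root unlink z).1 = None by exact/root_end/unlink_linking.
by rewrite !(unlink_None (e _)) // ?(blk_eq pp) ?(blk_eq rr).
Qed.

End TypeB.

(** * From a linking to a type B partition *)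

Section TypeBOfLinking.
Variable f : links n.
Hypothesis ff : linking f.

(** Roots commute with [bar], so fibres of the root map go to fibres; none is its own reflection
    because [bar] fixes no root. *)
Lemma part_typeB : typeB_partition (link_part f).
Proof.
have barV V : V \in link_part f -> exists2 p, V = finset.pblock (link_part f) p &
    @bar n @: V = finset.pblock (link_part f) (bar p).
  move=> Vf; have /and3P[_ tI V0] := link_partP f.
  have /set0Pn[p pV] : V != finset.set0 by apply: contraNneq V0 => <-.
  exists p; first by rewrite (def_pblock tI Vf pV).
  rewrite -(def_pblock tI Vf pV); apply/setP => r; rewrite mem_part -[r]barK.
  rewrite mem_imset ?mem_part; last exact/inv_inj/barK.
  by rewrite !root_bar (inj_eq (inv_inj barK)).
apply/and3P; split; first exact: link_partP.
  apply/forall_inP => V /barV[p _ ->]; apply: pblock_mem.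
  by have /and3P[/eqP-> _ _] := link_partP f; rewrite inE.
apply/forall_inP => V /barV[p EV ->]; rewrite EV.
apply: contraNneq (bar_neq (link_root f p)) => h.
by rewrite -root_bar eq_sym -mem_part -h mem_part.
Qed.

Lemma prev_part p r : block_prev (link_part f) p r = (f r.1 == Some (p.1, p.2 (+) r.2)).
Proof.
apply/block_prevP/eqP => [[]|E].
  rewrite mem_part => /eqP rp lt_pr pmax.
  have fr : f r.1 != None.
    apply: contraTneq lt_pr => fr; rewrite -leqNgt.
    by rewrite -[r](root_None fr) rp root_le.
  have le_rp : (link_step f r).1 <= p.1.
    by apply: pmax; rewrite ?mem_part ?root_step // step_lt.
  have rootE : link_root f (link_step f r) = link_root f p by rewrite root_step.
  have /(root_abs_inj rootE) <- : (link_step f r).1 = p.1.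
    (* If the step from [r] fell strictly below [p], [root_source] would give a point not beyond [p]
       with the same source as [r]. *)
    apply/val_inj/eqP; rewrite eqn_leq le_rp leqNgt; apply/negP => lt_rp.
    have [i si ip] := root_source ff rootE lt_rp.
    by move: lt_pr; rewrite (source_inj ff (source_step fr) si) ltnNge ip.
  by move: fr; rewrite /link_step; case: (f r.1) => [[j b]|] //= _; rewrite addbK.
have stepE : link_step f r = p by rewrite /link_step E /= addbK -surjective_pairing.
have fr : f r.1 != None by rewrite E.
split; [by rewrite mem_part -stepE root_step|by rewrite -stepE step_lt|].
move=> z; rewrite mem_part => /eqP rz lt_zr; rewrite leqNgt; apply/negP => lt_pz.
(* A point [z] of the block strictly between [p] and [r] would force a link to [p] from a point not
   beyond [z], yet only [r] is linked to [p]. *)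
have [|i si iz] := root_source ff _ lt_pz; first by rewrite -stepE root_step.
have := source_step fr; rewrite stepE => /(source_inj ff si) E'.
by move: lt_zr; rewrite -E' ltnNge iz.
Qed.

Lemma partK : unlink (link_part f) = f.
Proof.
apply/ffunP => i; have pB := part_typeB.
case E: (f i) => [[j b]|]; last first.
  rewrite ffunE; case: pickP => // p; by rewrite prev_part /= E.
by apply/eqP; rewrite -[b](addbK true) (unlinkE pB (j, b (+) true) (i, true)) prev_part /= E addbK.
Qed.

End TypeBOfLinking.

End Links.

Lemma sum_typeB (V : nmodType) n (G : {set {set signed n}} -> V) :
  \sum_(pi | typeB_partition pi) G pi = \sum_(f : links n | linking f) G (link_part f).
Proof.
rewrite (reindex_onto (@link_part n) (@unlink n)); last exact: unlinkK.
apply: eq_bigl => f; apply/andP/idP => [[fB /eqP<-]|ff].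
  exact: unlink_linking.
by rewrite part_typeB // partK.
Qed.

(** * Arcs and crossings *)

(** This matches the arcs, read off as neighbours in [block_seq], with the predecessor relation
    [block_prev]. *)
Lemma mem_zip_behead (T : eqType) (key : T -> nat) (s : seq T) (p r : T) :
  sorted (relpre key ltn) s ->
  reflect [/\ p \in s, r \in s, (key p < key r)%N &
             forall z, z \in s -> (key z < key r)%N -> (key z <= key p)%N]
          ((p, r) \in zip s (behead s)).
Proof.
move=> ss; have tr : transitive (relpre key ltn) by move=> ? ? ?; exact: ltn_trans.
apply: (iffP idP).
  elim: s ss => [|x [|y s] IH] //= /andP[xy ss].
  have sub_s := @mem_behead _ [:: x, y & s].
  rewrite inE => /orP[/eqP[-> ->]|/(IH ss)[ps rs pr max]].
    split=> //; rewrite ?mem_head ?inE ?eqxx ?orbT // => z.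
    rewrite !inE => /or3P[/eqP->//|/eqP->|zs]; first by rewrite ltnn.
    have /allP/(_ z zs) := order_path_min tr ss.
    by rewrite /= => /ltn_trans h /h; rewrite ltnn.
  split=> //; [exact: sub_s|exact: sub_s|].
  move=> z; rewrite inE => /orP[/eqP->|]; last exact: max.
  move=> _; apply: ltnW; suff /allP : all (fun z => key x < key z)%N (y :: s) by apply.
  by rewrite /= xy; apply/allP => w /(allP (order_path_min tr ss)) /=; exact: ltn_trans.
elim: s ss => [|x [|y s] IH] //= ss; first by case.
  by case; rewrite !inE => /eqP-> /eqP->; rewrite ltnn.
move: ss => /andP[xy ss] [ps rs pr max].
have sub_s := @mem_behead _ [:: x, y & s].
have minx z : z \in y :: s -> (key x < key z)%N.
  rewrite inE => /orP[/eqP->//|/(allP (order_path_min tr ss)) /=].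
  exact: ltn_trans.
have miny z : z \in y :: s -> (key y <= key z)%N.
  rewrite inE => /orP[/eqP->//|/(allP (order_path_min tr ss)) /=].
  exact: ltnW.
have {}rs : r \in y :: s.
  move: rs; rewrite inE => /orP[/eqP rx|//]; move: ps pr; rewrite rx inE.
  by move=> /orP[/eqP->|/minx /ltnW]; rewrite ?ltnn // leqNgt => /negPf->.
rewrite inE; move: ps; rewrite inE => /orP[/eqP px|ps].
  apply/orP; left; rewrite px xpair_eqE eqxx /=.
  move: rs; rewrite inE => /orP[//|rs].
  have yr : (key y < key r)%N.
    exact: (allP (order_path_min tr ss)).
  by have := max _ (sub_s _ (mem_head y s)) yr; rewrite px leqNgt xy.
apply/orP; right; apply: IH => //; split=> // z zs.
exact/max/sub_s.
Qed.

(** * B-arcs and predecessors in blocks *)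

Section BlockSeq.
Variables (n : nat) (pi : {set {set signed n}}).
Hypothesis piB : typeB_partition pi.
Implicit Types p r z : signed n.
Local Open Scope nat_scope.
Local Notation blk := (finset.pblock pi).
Local Notation abs_val := (fun p : signed n => p.1 : nat).

Lemma mem_block_seq (V : {set signed n}) p : (p \in block_seq V) = (p \in V).
Proof. by rewrite mem_sort mem_enum. Qed.

(** A block has at most one point of each absolute value, so the weak sorting order is strict on
    it. *)
Lemma block_seq_sorted p : sorted (relpre abs_val ltn) (block_seq (blk p)).
Proof.
rewrite -sorted_map ltn_sorted_uniq_leq sorted_map sort_sorted ?andbT; last first.
  by move=> r z; exact: leq_total.
rewrite map_inj_in_uniq ?sort_uniq ?enum_uniq // => r z.
by rewrite !mem_block_seq => rp zp /val_inj; exact: blk_abs_inj rp zp.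
Qed.

Lemma mem_Bblocks p : (blk p \in Bblocks pi) = positive_block (blk p).
Proof. by rewrite inE blk_in. Qed.

Lemma mem_Barcs p r :
  ((p, r) \in Barcs pi) = positive_block (blk r) && block_prev pi p r.
Proof.
rewrite inE; apply/exists_inP/andP => [[V]|[posr /block_prevP[h1 h2 h3]]].
  rewrite inE => /andP[Vpi Vpos].
  have /set0Pn[z zV] : V != finset.set0.
    by case/and3P: piB => /and3P[_ _ V0] _ _; apply: contraNneq V0 => <-.
  move: Vpos; rewrite -(def_blk piB Vpi zV) => Vpos.
  case/(mem_zip_behead _ _ (block_seq_sorted z)); rewrite !mem_block_seq.
  move=> pz rz lt_pr max; split; first by rewrite (blk_eq piB rz).
  apply/block_prevP; split=> //; first by rewrite (blk_eq piB rz).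
  by move=> w; rewrite (blk_eq piB rz) -mem_block_seq; exact: max.
exists (blk r); first by rewrite mem_Bblocks.
apply/(mem_zip_behead _ _ (block_seq_sorted r)).
by split=> [|||z]; rewrite ?mem_block_seq ?mem_blk //; exact: h3.
Qed.

Lemma blk_top p : exists2 z, z \in blk p & forall r, r \in blk p -> r.1 <= z.1.
Proof.
have pp := mem_blk piB p.
by case: (@arg_maxnP _ p (mem (blk p)) (fun z => z.1) pp) => /= z; exists z.
Qed.

Lemma positive_blk p z : z \in blk p -> (forall r, r \in blk p -> r.1 <= z.1) ->
  positive_block (blk p) = z.2.
Proof.
move=> zp zmax; apply/exists_inP/idP => [[r rp /andP[r2 /forall_inP rmax]]|z2].
  rewrite -(blk_abs_inj piB rp zp) //; apply/val_inj/eqP.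
  by rewrite eqn_leq rmax ?zmax.
by exists z => //; rewrite z2; apply/forall_inP.
Qed.

Lemma positive_blk_bar p : positive_block (blk (bar p)) = ~~ positive_block (blk p).
Proof.
have [z zp zmax] := blk_top p; rewrite (positive_blk zp zmax).
rewrite (@positive_blk _ (bar z)) ?mem_blk_bar // => r.
by rewrite -[r]barK mem_blk_bar //; exact: zmax.
Qed.

End BlockSeq.

(** Twice either side is the sum over ordered pairs of distinct elements, whatever the ranking. This
    lets the order of end points replace the ranks of arcs in [Rc]. *)
Lemma sum_pairs_inj (I : finType) (A : {pred I}) (c : I -> I -> nat)
    (r r' : I -> nat) :
  (forall i k, c i k = c k i) -> injective r -> injective r' ->
  (\sum_(i in A) \sum_(k in A | (r i < r k)%N) c i k =
   \sum_(i in A) \sum_(k in A | (r' i < r' k)%N) c i k)%N.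
Proof.
move=> cC.
suff main s : injective s ->
    ((\sum_(i in A) \sum_(k in A | (s i < s k)%N) c i k).*2 =
     \sum_(i in A) \sum_(k in A | k != i) c i k)%N.
  by move=> /main rE /main r'E; apply: double_inj; rewrite rE.
move=> s_inj; rewrite -addnn {2}(exchange_big_dep (mem A)) /=; last first.
  by move=> i k _ /andP[].
rewrite -big_split; apply: eq_bigr => i Ai /=.
rewrite [RHS](bigID (fun k => s i < s k)%N) /=; congr (_ + _)%N.
  apply: eq_bigl => k; case: (k \in A) => //=.
  by rewrite andbC; case: ltngtP => //= h; apply/esym; apply: contraTneq h => ->; rewrite ltnn.
apply: eq_big => [k|k _]; last exact: cC.
rewrite andbC -andbA; case: (k \in A) => /=; last by rewrite !andbF.
rewrite Ai; case: ltngtP => [h|h|/s_inj->]; rewrite ?eqxx /= ?andbF ?andbT //.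
by apply/esym; apply: contraTneq h => ->; rewrite ltnn.
Qed.

Section Arcs.
Variable n : nat.
Implicit Type a : signed n * signed n.

Lemma signed_int_bar (p : signed n) : signed_int (bar p) = - signed_int p.
Proof. by rewrite /signed_int /bar; case: p => i [] /=; rewrite ?opprK. Qed.

Lemma arc_min_bar a : arc_min (bar_arc a) = - arc_max a.
Proof. by rewrite /arc_min /arc_max /bar_arc !signed_int_bar oppr_max. Qed.

Lemma arc_max_bar a : arc_max (bar_arc a) = - arc_min a.
Proof. by rewrite /arc_min /arc_max /bar_arc !signed_int_bar oppr_min. Qed.

(** The end of larger absolute value decides: it is the maximum if positive and the minimum if
    negative. *)
Lemma arc_minE a : (a.1.1 < a.2.1)%N ->
  arc_min a = signed_int (if a.2.2 then a.1 else a.2).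
Proof.
rewrite /arc_min /signed_int; case: a => [[j s] [i t]] /= ji.
by case: s; case: t => /=; lia.
Qed.

Lemma arc_maxE a : (a.1.1 < a.2.1)%N ->
  arc_max a = signed_int (if a.2.2 then a.2 else a.1).
Proof.
rewrite /arc_max /signed_int; case: a => [[j s] [i t]] /= ji.
by case: s; case: t => /=; lia.
Qed.

End Arcs.

(** * [Na] and [Rc] in terms of links *)

Section Statistics.
Variables (n : nat) (f : links n).
Hypothesis ff : linking f.
Implicit Types (i j k : 'I_n).
Local Open Scope nat_scope.

Let fB := part_typeB f.

(** This is the sign with which [i] occurs in the positive block of its pair. *)
Definition block_sign i : bool := positive_block (finset.pblock (link_part f) (i, true)).

Lemma positive_pblock p :
  positive_block (finset.pblock (link_part f) p) = (p.2 == block_sign p.1).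
Proof.
case: p => i [] /=; rewrite -?[(i, false)]/(bar (i, true)).
  by rewrite eq_sym eqb_id.
by rewrite positive_blk_bar // /block_sign; case: positive_block.
Qed.

(** The representative in the positive block of the B-arc ending at [i]; meaningful only when [i]
    has a link. *)
Definition link_arc i : signed n * signed n :=
  (link_step f (i, block_sign i), (i, block_sign i)).

Lemma arc_inj : injective link_arc.
Proof. by move=> i k /(congr1 (fun a => a.2.1)). Qed.

Lemma arc_lt i : f i != None -> (link_arc i).1.1 < (link_arc i).2.1.
Proof. exact: (@step_lt _ _ ff (i, block_sign i)). Qed.

Lemma Barcs_part : Barcs (link_part f) = [set link_arc i | i in [pred i | f i != None]].
Proof.
apply/setP => -[p r]; rewrite mem_Barcs // positive_pblock prev_part //.
apply/andP/imsetP => [[/eqP r2 /eqP fr]|[k]].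
  exists r.1; first by rewrite inE fr.
  by rewrite /link_arc -r2 -surjective_pairing /link_step fr /= addbK -surjective_pairing.
rewrite inE => fk [-> ->] /=; rewrite eqxx /link_step /=.
by case: (f k) fk => [[j b]|] //= _; rewrite addbK.
Qed.

Definition negative_link i : bool := if f i is Some l then l.2 else false.

Lemma Na_part : Na (link_part f) = \sum_i negative_link i.
Proof.
rewrite /Na Barcs_part -sum1_card big_mkcond /=.
transitivity (\sum_(a in [set link_arc i | i in [pred i | f i != None]]) negative_arc a).
  rewrite [RHS]big_mkcond /=; apply: eq_bigr => a _.
  by rewrite inE; case: (a \in _) => //=; case: negative_arc.
rewrite big_imset /=; last by move=> i k _ _; exact: arc_inj.
rewrite big_mkcond; apply: eq_bigr => i _; rewrite inE.
rewrite /negative_link /negative_arc /link_arc /link_step /=.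
by case: (f i) => [[j b]|] //=; case: b; case: block_sign.
Qed.

(** Meant for [i < k]; the sign of the later arc does not matter. *)
Definition crossing i k : nat :=
  match f i, f k with
  | Some (j, b), Some (j', _) => if j' < i then if j < j' then 1 else b.*2 else 0
  | _, _ => 0
  end.

(** The end [k] lies outside the arc of [i] and its reflection, so each is crossed exactly when it
    encloses the start [j']. With [j < j' < i], exactly one of them does; with [j' < j], both do if
    they are negative, as they then span 0, and neither otherwise. *)
Lemma crossing_arc i k : f i != None -> f k != None -> i < k ->
  crosses (link_arc i) (link_arc k) + crosses (bar_arc (link_arc i)) (link_arc k) = crossing i k.
Proof.
move=> fi fk ik.
have := @source_lt _ _ ff i; have := @source_lt _ _ ff k.
have := @source_inj _ _ ff i k.
rewrite /crosses !arc_min_bar !arc_max_bar.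
rewrite !arc_minE ?arc_lt // !arc_maxE ?arc_lt //.
rewrite /link_arc /crossing /link_step /source /signed_int /=.
case: (f i) fi => [[j b]|] //= _; case: (f k) fk => [[j' b']|] //= _.
move=> /(_ j) + /(_ j') + /(_ j); rewrite !eqxx.
have [->|jj' _] := eqVneq j' j; first by move=> /(_ isT isT) ik'; rewrite ik' ltnn in ik.
move=> /(_ isT) h1 /(_ isT) h2.
have {}jj' : (j' : nat) <> j by move=> /val_inj/eqP; apply/negP.
clear -h1 h2 jj' ik.
by case: (ltnP j' i) => h5; case: (ltnP j j') => h6; case: (block_sign i);
  case: (block_sign k); case: b; case: b' => /=; lia.
Qed.

Lemma crosses_bar (a b : signed n * signed n) :
  crosses a b + crosses (bar_arc a) b = crosses b a + crosses (bar_arc b) a.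
Proof.
congr (_ + _); first by rewrite /crosses orbC.
by rewrite /crosses !arc_min_bar !arc_max_bar; congr nat_of_bool; lia.
Qed.

Lemma Rc_part : Rc (link_part f) = \sum_(i < n) \sum_(k < n | i < k) crossing i k.
Proof.
rewrite /Rc Barcs_part big_imset /=; last by move=> i k _ _; exact: arc_inj.
under eq_bigr => i _.
  rewrite big_imset_cond /=; last by move=> x y _ _; exact: arc_inj.
  over.
rewrite (@sum_pairs_inj _ [pred i | f i != None]
  (fun i k => crosses (link_arc i) (link_arc k) +
              crosses (bar_arc (link_arc i)) (link_arc k))
  (fun i => enum_rank (link_arc i)) (@nat_of_ord n)); first last.
- exact: val_inj.
- by move=> i k /val_inj/enum_rank_inj/arc_inj.
- by move=> i k; exact: crosses_bar.
rewrite big_mkcond; apply: eq_bigr => i _; rewrite inE.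
case: ifPn => [fi|/negPn/eqP fi]; last first.
  by rewrite big1 // => k _; rewrite /crossing fi.
rewrite big_mkcond [RHS]big_mkcond; apply: eq_bigr => k _; rewrite inE /=.
case: ifPn => [/andP[fk ik]|]; first by rewrite ik crossing_arc.
rewrite negb_and negbK => /orP[/eqP fk|/negPf->//].
by rewrite /crossing fk; case: (f i) => [[]|]; rewrite if_same.
Qed.

End Statistics.

(** * Cumulants *)

Lemma zip_behead_sorted (T : eqType) (e : rel T) (s : seq T) :
  (forall p r, (p, r) \in zip s (behead s) -> e p r) -> sorted e s.
Proof.
elim: s => [|x [|y s] IH] //= h; rewrite h ?mem_head //=.
by apply: IH => p r pr; apply: h; rewrite inE pr orbT.
Qed.

Section Cumulants.
Variables (C : numClosedFieldType) (V : lmodType C) (ip : V -> V -> C).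
Variables (n : nat) (x : signed n -> V) (T : signed n -> V -> V).
Variable lam : signed n -> C.
Implicit Types (f : links n) (p r z : signed n) (i j k : 'I_n).

(** The argument [m] is fuel for the descent along the block; any value above the absolute value of
    [p] gives the same vector. *)
Fixpoint chain_rec f m p : V :=
  if m is m'.+1 then
    if f p.1 is Some _ then T p (chain_rec f m' (link_step f p)) else x p
  else x p.

(** With [p = i_k] in its block, this is [T_{i_k} ... T_{i_2} x_{i_1}], the tensor factor that [p]
    leaves in the Fock space while open. *)
Definition chain f p : V := chain_rec f n p.

Lemma chain_rec_fuel f m m' p : linking f -> (p.1 < m)%N -> (p.1 < m')%N ->
  chain_rec f m p = chain_rec f m' p.
Proof.
move=> ff; elim: m m' p => [|m IH] [|m'] //= p pm pm'.
case E: (f p.1) => [l|] //; congr (T p _).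
have lt_p : ((link_step f p).1 < p.1)%N by rewrite step_lt ?E.
by apply: IH; apply: leq_trans lt_p _.
Qed.

Lemma chainE f p : linking f ->
  chain f p = if f p.1 is Some _ then T p (chain f (link_step f p)) else x p.
Proof.
move=> ff; rewrite /chain.
have -> : chain_rec f n p = chain_rec f n.+1 p.
  by apply: chain_rec_fuel => //; rewrite ltnS ltnW.
by [].
Qed.

(** Only links at points up to [p] enter, so a factor is known as soon as these links are fixed. *)
Lemma chain_local f g p : linking f -> linking g ->
  (forall i, (i <= p.1)%N -> f i = g i) -> chain f p = chain g p.
Proof.
move=> ff gg; move: {2}(p.1 : nat).+1 (ltnSn p.1) => m.
elim: m p => // m IH p; rewrite ltnS => pm fg.
rewrite (chainE p ff) (chainE p gg) fg //; case E: (g p.1) => [l|] //; congr (T p _).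
have stepE : link_step f p = link_step g p by rewrite /link_step fg.
have lt_p : ((link_step g p).1 < p.1)%N by rewrite step_lt ?E.
rewrite stepE; apply: IH; first exact: leq_trans lt_p pm.
by move=> i ip'; apply: fg; apply: leq_trans ip' (ltnW lt_p).
Qed.

Definition final f i : bool := [forall k, ~~ source f k i].

Lemma finalPn f i : reflect (exists k, source f k i) (~~ final f i).
Proof.
rewrite negb_forall; apply: (iffP existsP) => -[k] sk; exists k; last by rewrite negbK.
exact/negPn.
Qed.

(** The cumulant of a whole block, charged to its last point [i]. *)
Definition end_weight f i : C :=
  if f i is Some _ then
    ip (x (i, false)) (chain f (link_step f (i, false))) *
    ip (x (i, true)) (chain f (link_step f (i, true)))
  else lam (i, false) * lam (i, true).

(** * Block cumulants along chains *)

Section Linking.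
Variable f : links n.
Hypothesis ff : linking f.
Let fB := part_typeB f.
Local Notation blk := (finset.pblock (link_part f)).

Definition linked p r : bool := f r.1 == Some (p.1, p.2 (+) r.2).

Lemma linked_step p r : linked p r -> link_step f r = p.
Proof.
by rewrite /linked /link_step => /eqP->; rewrite /= addbK -surjective_pairing.
Qed.

Lemma linked_bar p r : linked (bar p) (bar r) = linked p r.
Proof. by rewrite /linked /= addbN addNb negbK. Qed.

Lemma block_seq_linked p : sorted linked (block_seq (blk p)).
Proof.
apply: zip_behead_sorted => z r.
case/(mem_zip_behead _ _ (block_seq_sorted fB p)); rewrite !mem_block_seq.
move=> zp rp lt_zr max; rewrite /linked -(prev_part ff).
apply/block_prevP; split; rewrite ?(blk_eq fB rp) // => w.
by rewrite -mem_block_seq; exact: max.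
Qed.

Lemma chain_foldl z s : f z.1 = None -> path linked z s ->
  foldl (fun v r => T r v) (x z) s = chain f (last z s).
Proof.
move=> fz; elim/last_ind: s => [|s r IH] /=; first by rewrite chainE // fz.
rewrite rcons_path foldl_rcons last_rcons => /andP[/IH-> zr].
by rewrite [RHS]chainE // (linked_step zr) (eqP zr).
Qed.

Lemma moment_chain z s r : f z.1 = None -> path linked z (rcons s r) ->
  moment ip x T z (rcons s r) = ip (x r) (chain f (link_step f r)).
Proof.
move=> fz; rewrite rcons_path => /andP[zs sr].
by rewrite /moment last_rcons belast_rcons /= chain_foldl // (linked_step sr).
Qed.

(** By [root_source], a larger point of the block would force some link to start at [i]. *)
Lemma final_max i s r : final f i -> r \in blk (i, s) -> (r.1 <= i)%N.
Proof.
move=> /forallP fi; rewrite mem_part => /eqP ir; rewrite leqNgt; apply/negP => lt.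
by have [k sk _] := root_source ff ir lt; move: (fi k); rewrite sk.
Qed.

Lemma max_final z : (forall r, r \in blk z -> (r.1 <= z.1)%N) -> final f z.1.
Proof.
move=> zmax; apply/forallP => k; apply/negP => sk.
have := source_lt ff sk; move: sk; rewrite /source.
case E: (f k) => [[j b]|] //= /eqP jz; apply/negP; rewrite -leqNgt.
(* The sign is chosen so that the step lands on [z], which puts a point beyond [z] in its block. *)
have zE : link_step f (k, b (+) z.2) = z.
  by rewrite /link_step /= E /= jz addKb -surjective_pairing.
by apply: (zmax (k, b (+) z.2)); rewrite mem_part -(root_step ff (k, _)) zE.
Qed.

Lemma block_cumulant_part i : final f i ->
  block_cumulant ip x T lam (blk (i, true)) = end_weight f i.
Proof.
move=> fi; rewrite /block_cumulant.
have := block_seq_linked (i, true); have := block_seq_sorted fB (i, true).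
have mem z : (z \in block_seq (blk (i, true))) = (z \in blk (i, true)).
  exact: mem_block_seq.
case: (block_seq _) mem => [|z s] mem ss sl.
  by have := mem (i, true); rewrite mem_blk.
(* The sequence starts at the first point of the block: a step from [z] would stay in the block at a
   smaller absolute value. *)
have fz : f z.1 = None.
  case E: (f z.1) => [l|] //.
  have lt_z : ((link_step f z).1 < z.1)%N by rewrite step_lt ?E.
  have : link_step f z \in z :: s.
    rewrite mem mem_part root_step // -mem_part -mem; exact: mem_head.
  rewrite inE => /orP[/eqP zE|]; first by rewrite zE ltnn in lt_z.
  have tr : transitive (relpre (fun p => p.1 : nat) ltn).
    by move=> ? ? ?; exact: ltn_trans.
  by move=> /(allP (order_path_min tr ss)) /= /ltnW; rewrite leqNgt lt_z.
have lastE : last z s = (i, true).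
  have lz : last z s \in blk (i, true) by rewrite -mem mem_last.
  apply: (blk_abs_inj fB lz (mem_blk fB _)); apply/val_inj/eqP.
  rewrite eqn_leq (final_max fi lz) /=.
  have : (i, true) \in z :: s by rewrite mem mem_blk.
  have tr : transitive (relpre (fun p : signed n => p.1 : nat) ltn).
    by move=> ? ? ?; exact: ltn_trans.
  elim/last_ind: s ss {mem sl lz} => [|s r _] /=.
    by rewrite inE => _ /eqP<-.
  rewrite last_rcons -cats1 -cat_cons mem_cat mem_seq1 => ss /orP[|/eqP<-//].
  move: ss; rewrite -[path _ _ _]/(sorted _ (z :: s ++ [:: r])) -cat_cons.
  rewrite sorted_pairwise // pairwise_cat => /and3P[/allrelP h _ _] zi.
  by apply: ltnW; apply: (h (i, true) r); rewrite ?mem_head.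
case/lastP: s => [|s r] in mem ss sl lastE *.
  rewrite /end_weight /=; move: lastE fz => /= -> /= -> .
  by [].
rewrite last_rcons in lastE; rewrite lastE in sl *.
have -> : forall (A : Type) (a b : A),
    match rcons s (i, true) with [::] => a | _ :: _ => b end = b.
  by case: (s).
(* The reflected sequence also follows the links, by [linked_bar], so both moments are read from
   chains. *)
rewrite map_rcons !moment_chain //; last first.
  by rewrite -map_rcons path_map (eq_path linked_bar).
rewrite /end_weight; move: sl; rewrite /= rcons_path => /andP[_ /eqP/= ->].
by [].
Qed.

(** Sending [i] to the block of [+i] is a bijection from the final points onto the positive
    blocks. *)
Lemma partition_cumulant_part :
  partition_cumulant ip x T lam (link_part f) = \prod_(i | final f i) end_weight f i.
Proof.
rewrite /partition_cumulant.
have -> : Bblocks (link_part f) = [set blk (i, true) | i in final f].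
  apply/setP => B; apply/idP/imsetP => [|[i fi ->]].
    rewrite inE => /andP[Bf Bpos].
    have /set0Pn[z zB] : B != finset.set0.
      by case/and3P: fB => /and3P[_ _ B0] _ _; apply: contraNneq B0 => <-.
    move: Bpos; rewrite -(def_blk fB Bf zB).
    have [p pz pmax] := blk_top fB z; rewrite (positive_blk fB pz pmax) => p2.
    rewrite -(blk_eq fB pz) in pmax *.
    by exists p.1; [exact: max_final|rewrite -p2 -surjective_pairing].
  rewrite mem_Bblocks // (positive_blk fB (mem_blk fB _)) // => r.
  exact: final_max.
rewrite big_imset /=; first exact/eq_bigr/block_cumulant_part.
move=> i k fi fk ik; apply/val_inj/eqP; rewrite eqn_leq.
rewrite (@final_max k true (i, true)) // -?ik ?mem_blk //.
by rewrite (@final_max i true (k, true)) // ik mem_blk.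
Qed.

End Linking.

End Cumulants.

(** * The vacuum coefficient *)

Section SortedEnum.
Variable n : nat.
Implicit Types (S : {set 'I_n}) (i j : 'I_n).
Local Open Scope nat_scope.
Local Notation ltv := (relpre (@nat_of_ord n) ltn).

Lemma ltv_trans : transitive ltv.
Proof. by move=> ? ? ?; exact: ltn_trans. Qed.

Lemma enum_set_sorted S : sorted ltv (enum S).
Proof.
rewrite {1}/enum_mem; apply: sorted_filter; first exact: ltv_trans.
by rewrite -enumT -sorted_map val_enum_ord iota_ltn_sorted.
Qed.

Lemma enum_setU1_max S i : (forall j, j \in S -> j < i) ->
  enum (i |: S) = rcons (enum S) i.
Proof.
move=> Si; apply: (irr_sorted_eq ltv_trans) => [j|||j].
- by rewrite /= ltnn.
- exact: enum_set_sorted.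
- rewrite -cats1 sorted_pairwise; last exact: ltv_trans.
  rewrite pairwise_cat -sorted_pairwise ?enum_set_sorted ?andbT; last exact: ltv_trans.
  by apply/allrelP => j k; rewrite mem_enum inE /= => /Si + /eqP->.
- by rewrite mem_rcons in_cons !mem_enum !inE.
Qed.

Lemma enum_setD1 S j s1 s2 : enum S = s1 ++ j :: s2 ->
  [/\ enum (S :\ j) = s1 ++ s2, all (fun k : 'I_n => k < j) s1 & all (fun k : 'I_n => j < k) s2].
Proof.
move=> ES; have := enum_set_sorted S; rewrite ES.
rewrite sorted_pairwise; last exact: ltv_trans.
rewrite pairwise_cat /= => /and3P[/allrelP h1 h2 /andP[h3 h4]].
have s1j : all (fun k : 'I_n => k < j) s1 by apply/allP => k k1; apply: h1; rewrite ?mem_head.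
have s2j : all (fun k : 'I_n => j < k) s2 by exact: h3.
split=> //; apply: (irr_sorted_eq ltv_trans) => [k|||k].
- by rewrite /= ltnn.
- exact: enum_set_sorted.
- rewrite sorted_pairwise; last exact: ltv_trans.
  rewrite pairwise_cat h2 h4 !andbT; apply/allrelP => a b a1 b2.
  by apply: h1; rewrite ?inE ?b2 ?orbT.
- have : k \in S = (k \in s1 ++ j :: s2) by rewrite -ES mem_enum.
  rewrite mem_enum !inE !mem_cat in_cons => ->.
  case: eqVneq => [->|//] /=; apply/esym/negbTE; rewrite negb_or.
  by apply/andP; split; apply/negP; [move/(allP s1j)|move/(allP s2j)]; rewrite ltnn.
Qed.

(** The exponent of [q] for acting on the factor of [j], [S] being the other open points: one per
    factor outside, and two per factor inside if the action is crossed. *)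
Definition shift_cost (b : bool) j (S : {set 'I_n}) : nat :=
  \sum_(t in S) (if j < t then 1 else b.*2).

Lemma shift_costE b S j s1 s2 : enum S = s1 ++ j :: s2 ->
  shift_cost b j (S :\ j) = size s2 + b * (size s1).*2.
Proof.
case/enum_setD1 => ES s1j s2j; rewrite /shift_cost -big_enum ES big_cat /= addnC.
congr (_ + _).
  rewrite big_seq (eq_bigr (fun=> 1)) => [|k /(allP s2j) -> //].
  by rewrite -big_seq sum1_size.
rewrite big_seq (eq_bigr (fun=> b.*2)) => [|k /(allP s1j)]; last first.
  by rewrite ltnNge => kj; rewrite ifN // -leqNgt ltnW // ltnNge.
rewrite -big_seq big_const_seq count_predT iter_addn_0.
by case: b => /=; lia.
Qed.

End SortedEnum.

(** * Action of one operator, seen from the vacuum *)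

Section VacuumCoefficient.
Variables (C : numClosedFieldType) (V : lmodType C).
Variables (ip : V -> V -> C) (alpha q : C).
Hypothesis ip_linear : forall u, linear (ip u : V -> C^o).
Hypothesis ip_hermitian : forall u v, ip v u = (ip u v)^*.

Lemma linear_funD (W W' : lmodType C) (h : W -> W') : linear h ->
  forall u v, h (u + v) = h u + h v.
Proof. by move=> hl u v; have := hl 1 u v; rewrite !scale1r. Qed.

Lemma linear_fun0 (W W' : lmodType C) (h : W -> W') : linear h -> h 0 = 0.
Proof.
by move=> /linear_funD hD; apply: (addIr (h 0)); rewrite -hD !add0r.
Qed.

Lemma linear_funZ (W W' : lmodType C) (h : W -> W') : linear h ->
  forall a u, h (a *: u) = a *: h u.
Proof.
by move=> hl a u; have := hl a u 0; rewrite !addr0 (linear_fun0 hl) addr0.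
Qed.

Lemma linear_fun_sum (W W' : lmodType C) (h : W -> W') : linear h ->
  forall (I : Type) (r : seq I) (A : pred I) (F : I -> W),
  h (\sum_(i <- r | A i) F i) = \sum_(i <- r | A i) h (F i).
Proof.
by move=> hl I r A F; apply: big_morph; [exact: linear_funD|exact: linear_fun0].
Qed.

Definition vacuum_coef (v : fock V) : C := deformed_ip ip alpha q vacuum v.

Lemma vacuum_coef_linear : linear (vacuum_coef : fock V -> C^o).
Proof.
move=> a u v; rewrite /vacuum_coef /deformed_ip /symmetrizer.
rewrite (lift_is_linear (@symmetrizer_word_multilinear _ _ alpha q)).
exact: (free_ip_linear ip_linear).
Qed.

(** Words of different lengths are orthogonal, and the symmetrizer fixes the vacuum. *)
Lemma vacuum_coef_tens w : vacuum_coef (tens w) = (size w == 0%N)%:R.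
Proof.
rewrite /vacuum_coef /deformed_ip symmetrizer_tens /symmetrizer_word.
have fl := free_ip_linear ip_linear (vacuum : fock V).
rewrite (linear_fun_sum fl).
rewrite (eq_bigr (fun s => alpha ^+ l1 s * q ^+ l2 s * (size w == 0%N)%:R)).
  case: (size w =P 0%N) => [-> |_]; last by rewrite big1 // => s _; rewrite mulr0.
  (* For the empty word the group is trivial and its only reduced word is empty, so no power of
     [alpha] or [q] appears. *)
  have nil0 (s : seq 'I_0) : s = [::] by case: s => [//|[]].
  rewrite (big_pred1 1%g) => [|s].
    by rewrite /l1 /l2 (nil0 (reduced_word _)) !expr0 !mulr1.
  rewrite inE; have -> : s = 1%g by apply/permP => -[[]].
  by rewrite /= eqxx; apply/forallP => -[[]].
move=> s _; rewrite (linear_funZ fl) -[_ *: _]/(_ * _); congr (_ * _).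
rewrite (free_ip_tens ip_linear ip_hermitian) /ip_word size_map size_enum_ord /=.
by rewrite eq_sym; case: eqP => // _; case: (word_perm _ _) => [|? ?]; rewrite big_nil.
Qed.

Variables (n : nat) (x : signed n -> V) (T : signed n -> {linear V -> V}).
Variable lam : signed n -> C.

Definition poisson (i : 'I_n) : fock V -> fock V :=
  double_poisson ip alpha q (x (i, false)) (x (i, true))
    (T (i, false)) (T (i, true)) (lam (i, false)) (lam (i, true)).

Lemma poisson_linear i : linear (poisson i).
Proof.
have linD (h h' : fock V -> fock V) : linear h -> linear h' ->
    linear (fun v => h v + h' v).
  by move=> hl hl' a u v /=; rewrite hl hl' scalerDr addrACA.
have linZ c : linear (fun v : fock V => c *: v).
  by move=> a u v /=; rewrite scalerDr !scalerA mulrC.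
have lA := lift_is_linear (annihilation_word_multilinear alpha q ip_linear
  (x (i, false)) (x (i, true))).
have lK := lift_is_linear (@creation_word_multilinear _ _
  (x (i, false)) (x (i, true))).
have lG := lift_is_linear (gauge_word_multilinear alpha q
  (T (i, false)) (T (i, true))).
exact: (linD _ _ (linD _ _ (linD _ _ lA lK) lG) (linZ _)).
Qed.

Definition moment_from (s : seq 'I_n) (v : fock V) : C :=
  vacuum_coef (foldl (fun v i => poisson i v) v s).

Lemma moment_from_linear s : linear (moment_from s : fock V -> C^o).
Proof.
elim: s => [|i s IH] a u v; first exact: vacuum_coef_linear.
by rewrite /moment_from /= poisson_linear; exact: IH.
Qed.

(** Swapping the two legs turns a straight term of the annihilation or gauge formula into a crossed
    one. *)
Definition twist (b : bool) (p : V * V) : V * V := if b then (p.2, p.1) else p.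

Lemma moment_from_cons i s w :
  moment_from (i :: s) (tens w) =
  lam (i, false) * lam (i, true) * moment_from s (tens w) +
  moment_from s (tens (rcons w (x (i, false), x (i, true)))) +
  \sum_(k < size w) \sum_(b : bool)
    alpha ^+ b * q ^+ (size w - k.+1 + b * k.*2) *
    (let p := twist b (nth (0, 0) w k) in
     ip (x (i, false)) p.1 * ip (x (i, true)) p.2 * moment_from s (tens (del k w)) +
     moment_from s (tens (rcons (del k w) (T (i, false) p.1, T (i, true) p.2)))).
Proof.
have ml := moment_from_linear s.
rewrite -[LHS]/(moment_from s (poisson i (tens w))) /poisson /double_poisson.
rewrite annihilation_tens // creation_tens gauge_tens.
rewrite /annihilation_word /gauge_word.
have mD u v : moment_from s (u + v) = moment_from s u + moment_from s v.
  exact: (linear_funD ml).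
have mZ a u : moment_from s (a *: u) = a * moment_from s u.
  exact: (linear_funZ ml).
have mS (F : 'I_(size w) -> fock V) :
    moment_from s (\sum_k F k) = \sum_k moment_from s (F k).
  exact: (linear_fun_sum ml).
rewrite !mD !mZ !mS; set a1 := \sum_k _; set a2 := \sum_k _.
set g1 := \sum_k _; set g2 := \sum_k _; set t := \sum_k _.
suff -> : t = a1 + alpha * q ^+ (size w).-1 * a2 +
              (g1 + alpha * q ^+ (size w).-1 * g2) by ring.
rewrite /a1 /a2 /g1 /g2 !mulr_sumr -!big_split /=; apply: eq_bigr => k _.
rewrite big_bool !mZ /lpart /rpart /= expr0 expr1 mul0n addn0 mul1n.
(* The exponent of a crossed term counts the outer factors once and the [k] inner factors twice. *)
have -> : (size w - k.+1 + k.*2 = (size w).-1 + k)%N by have := ltn_ord k; lia.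
by rewrite exprD; case: (nth _ w k) => u v /=; ring.
Qed.

Lemma moment_from_set i s (S : {set 'I_n}) (y : 'I_n -> V * V) :
  moment_from (i :: s) (tens (map y (enum S))) =
  lam (i, false) * lam (i, true) * moment_from s (tens (map y (enum S))) +
  moment_from s (tens (rcons (map y (enum S)) (x (i, false), x (i, true)))) +
  \sum_(j in S) \sum_(b : bool)
    alpha ^+ b * q ^+ shift_cost b j (S :\ j) *
    (let p := twist b (y j) in let w := map y (enum (S :\ j)) in
     ip (x (i, false)) p.1 * ip (x (i, true)) p.2 * moment_from s (tens w) +
     moment_from s (tens (rcons w (T (i, false) p.1, T (i, true) p.2)))).
Proof.
rewrite moment_from_cons size_map; congr (_ + _).
rewrite -[RHS]big_enum /= [RHS](big_nth i) big_mkord; apply: eq_bigr => k _; apply: eq_bigr => b _.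
have kS := ltn_ord k; set j := nth i (enum S) k.
have ES : enum S = take k (enum S) ++ j :: drop k.+1 (enum S).
  by rewrite -drop_nth // cat_take_drop.
have k1 : size (take k (enum S)) = k by rewrite size_take kS.
rewrite (shift_costE b ES) k1 size_drop (nth_map i) // -/j.
have [-> _ _] := enum_setD1 ES.
have -> : del k (map y (enum S)) =
    map y (take k (enum S) ++ drop k.+1 (enum S)).
  have -> : map y (enum S) =
      map y (take k (enum S)) ++ y j :: map y (drop k.+1 (enum S)).
    by rewrite -map_cons -map_cat -ES.
  by rewrite map_cat -[X in del X _]k1 -[X in del X _](size_map y) del_cat_eq.
by [].
Qed.

End VacuumCoefficient.

(** * Summation over the links *)

Section Prefixes.
Variable n : nat.
Implicit Types (f g : links n) (S : {set 'I_n}) (i j k : 'I_n).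
Implicit Types (a : option ('I_n * bool)) (m : nat).
Local Open Scope nat_scope.

(* The points below [m] whose block has a point at or beyond [m]: the factors of
   the word on which the operator number [m] acts. *)
Definition opens f m : {set 'I_n} :=
  [set j : 'I_n | (j < m) && [exists k : 'I_n, (m <= k) && source f k j]].

Lemma opensP f m j :
  reflect (j < m /\ exists2 k : 'I_n, m <= k & source f k j) (j \in opens f m).
Proof.
rewrite inE; apply: (iffP andP) => -[jm h]; split=> //.
  by case/existsP: h => k /andP[mk kj]; exists k.
by case: h => k mk kj; apply/existsP; exists k; rewrite mk.
Qed.

(** The linkings compatible with the state [(g, S)] reached before operator number [m]: links fixed
    below [m], and [S] the open points. *)
Definition extends g S m f : bool :=
  [&& linking f, [forall i : 'I_n, (i < m) ==> (f i == g i)] & opens f m == S].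

Definition link_prefix g S m : Prop :=
  [/\ linking g, forall i : 'I_n, m <= i -> g i = None &
      forall j, j \in S -> j < m /\ final g j].

Definition link_source a : {set 'I_n} :=
  if a is Some l then [set l.1] else finset.set0.

Lemma mem_link_source f i j : (j \in link_source (f i)) = source f i j.
Proof.
by rewrite /link_source /source; case: (f i) => [l|]; rewrite inE // eq_sym.
Qed.

Definition relink g i a : links n := [ffun k => if k == i then a else g k].

(** The next open set: the source of the link is closed, and [o] tells whether [i] stays open. *)
Definition reopen S i a (o : bool) : {set 'I_n} :=
  if o then i |: (S :\: link_source a) else S :\: link_source a.

Lemma opens_succ f i : linking f ->
  opens f i.+1 = reopen (opens f i) i (f i) (~~ final f i).
Proof.
move=> ff; apply/setP => j; rewrite /reopen.
have -> : (j \in opens f i.+1) = (j == i) && ~~ final f i ||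
    (j \in opens f i :\: link_source (f i)).
  apply/opensP/orP => [[ji [k ik kj]]|[/andP[/eqP-> /finalPn[k ki]]|]].
  - move: ji; rewrite ltnS leq_eqVlt => /orP[/eqP/val_inj jE|ji].
      by left; rewrite jE eqxx; apply/finalPn; exists k; rewrite -jE.
    right; rewrite inE mem_link_source; apply/andP; split.
      apply/negP => ij; have ki := source_inj ff kj ij.
      by move: ik; rewrite ki ltnn.
    by apply/opensP; split=> //; exists k => //; exact: ltnW.
  - by split=> //; exists k => //; exact: (source_lt ff ki).
  - rewrite inE mem_link_source => /andP[ij /opensP[ji [k ik kj]]].
    split; first exact: ltnW.
    exists k => //; rewrite ltn_neqAle ik andbT.
    by apply: contraNneq ij => /val_inj ->.
by case: final; rewrite /= ?andbF ?andbT //= !inE.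
Qed.

(** Inverse of [opens_succ]: the open set is recovered from the next one. *)
Lemma opens_split f i : linking f ->
  opens f i = (opens f i.+1 :\ i) :|: link_source (f i).
Proof.
move=> ff; apply/setP => j.
rewrite finset.in_setU finset.in_setD1 mem_link_source.
apply/opensP/orP => [[ji [k ik kj]]|[/andP[ji /opensP[+ [k ik kj]]]|ij]].
- move: ik; rewrite leq_eqVlt => /orP[/eqP/val_inj ik|ik].
    by right; rewrite ik.
  left; apply/andP; split; first by apply: contraTneq ji => ->; rewrite ltnn.
  by apply/opensP; split; [exact: ltnW|exists k].
- rewrite ltnS leq_eqVlt => /orP[/eqP/val_inj jE|ji'].
    by rewrite jE eqxx in ji.
  by split=> //; exists k => //; exact: ltnW.
- by split; [exact: (source_lt ff ij)|exists i].
Qed.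

Lemma mem_reopen S i a o : i \notin S -> (i \in reopen S i a o) = o.
Proof. by move=> /negPf iS; rewrite /reopen; case: o; rewrite !inE ?eqxx ?iS ?andbF. Qed.

Lemma prefix_notin g S i : link_prefix g S i -> i \notin S.
Proof. by case=> _ _ gS; apply/negP => /gS[]; rewrite ltnn. Qed.

Lemma extends_relink g S i a o f : link_prefix g S i -> link_source a \subset S ->
  extends g S i f && ((f i == a) && (~~ final f i == o)) =
  extends (relink g i a) (reopen S i a o) i.+1 f.
Proof.
move=> gS aS; have iS := prefix_notin gS.
apply/andP/and3P => [[/and3P[ff /forallP h /eqP SE] /andP[/eqP fi /eqP fo]]|].
  split=> //; last by rewrite opens_succ // SE fi fo.
  apply/forallP => k; apply/implyP; rewrite ltnS ffunE => ki.
  case: (eqVneq k i) => [->|kni]; first by rewrite fi.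
  by apply: (implyP (h k)); rewrite ltn_neqAle kni.
move=> [ff /forallP h /eqP oE].
have fi : f i = a.
  by move: (h i); rewrite ltnSn ffunE eqxx => /eqP.
(* Since [i] is not in [S], its membership in the next open set records the flag [o]. *)
have fo : ~~ final f i = o.
  rewrite -(mem_reopen a o iS) -oE opens_succ // mem_reopen //.
  by apply/opensP => -[]; rewrite ltnn.
rewrite fi fo !eqxx; split=> //; apply/and3P; split=> //.
  apply/forallP => k; apply/implyP => ki; move: (h k).
  rewrite ltnS (ltnW ki) ffunE; case: (eqVneq k i) => // kE.
  by rewrite kE ltnn in ki.
rewrite opens_split // oE fi; apply/eqP/setP => j.
have := fintype.subsetP aS j; rewrite /reopen finset.in_setU finset.in_setD1.
case: (eqVneq j i) => [->|ji] /=.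
  by rewrite (negPf iS); case: (i \in link_source a) => // /(_ isT).
rewrite (fun_if (fun X : {set 'I_n} => j \in X)) finset.in_setU1 (negPf ji) if_same.
by rewrite finset.in_setD; case: (j \in link_source a) => [->|]; rewrite ?orbF.
Qed.

Lemma extends_source g S i f : extends g S i f -> link_source (f i) \subset S.
Proof.
case/and3P => ff _ /eqP <-; apply/fintype.subsetP => j; rewrite mem_link_source => ij.
by apply/opensP; split; [exact: (source_lt ff ij)|exists i].
Qed.

Lemma source_relink g i a k j :
  source (relink g i a) k j = if k == i then j \in link_source a else source g k j.
Proof.
rewrite -mem_link_source ffunE; case: (k == i) => //.
by rewrite mem_link_source.
Qed.

(** The source of the new link was final for [g], so no source is used twice; once it is removed,
    the remaining open points are still final. *)
Lemma prefix_relink g S i a o : link_prefix g S i -> link_source a \subset S ->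
  link_prefix (relink g i a) (reopen S i a o) i.+1.
Proof.
move=> gSi /fintype.subsetP aS; have iS := prefix_notin gSi; case: gSi => gg g0 gS.
split.
- apply/linkingP; split=> [k j|k k' j].
    rewrite source_relink; case: (eqVneq k i) => [->|_]; first by case/aS/gS.
    exact: source_lt.
  rewrite !source_relink.
  case: (eqVneq k i) => [->|ki]; case: (eqVneq k' i) => [->|ki'] //.
  + by move=> /aS/gS[_ /forallP/(_ k')/negPf->].
  + by move=> kj /aS/gS[_ /forallP/(_ k)]; rewrite kj.
  + exact: source_inj.
- move=> k ik; rewrite ffunE; case: (eqVneq k i) => [kE|_]; last exact/g0/ltnW.
  by rewrite kE ltnn in ik.
- move=> j jS; have {jS} : j = i \/ (j \in S /\ j \notin link_source a).
    move: jS; rewrite /reopen; case: o; rewrite !inE.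
      by case/orP => [/eqP|/andP[]]; [left|right].
    by case/andP; right.
  case=> [->|[jS ja]].
    split=> //; apply/forallP => k; rewrite source_relink.
    case: (eqVneq k i) => [_|_]; first by apply: contra iS; exact: aS.
    apply/negP => ki; have := g0 k (ltnW (source_lt gg ki)).
    by move: ki; rewrite /source; case: (g k).
  have [ji /forallP gj] := gS _ jS; split; first exact: ltnW.
  by apply/forallP => k; rewrite source_relink; case: (k == i).
Qed.

(* Each later arc that meets the arc of [i] starts at a point still open at
   time [i], and an open point starts exactly one later arc. *)
Lemma crossing_sum f i j b : linking f -> f i = Some (j, b) ->
  \sum_(k < n | i < k) crossing f i k = shift_cost b j (opens f i :\ j).
Proof.
move=> ff fi; pose phi (t : 'I_n) := if j < t then 1 else b.*2.
transitivity (\sum_(k < n | i < k) \sum_(t < n | source f k t && (t < i)) phi t).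
  apply: eq_bigr => k _; rewrite /crossing fi /source.
  case: (f k) => [[t c]|] /=; last by rewrite big_pred0.
  case: ifP => ti.
    by rewrite (big_pred1 t) // => u /=; case: eqVneq => [<-|]; rewrite ?ti.
  by rewrite big_pred0 // => u; case: eqVneq => [<-|]; rewrite ?ti.
rewrite (exchange_big_dep predT) //= /shift_cost [RHS]big_mkcond /=.
apply: eq_bigr => t _; case: ifPn => [|tS].
  rewrite finset.in_setD1 => /andP[tj /opensP[ti [k ik kt]]].
  rewrite (big_pred1 k) // => u /=; rewrite ti andbT.
  apply/andP/eqP => [[_ ut]|->]; first exact: (source_inj ff ut kt).
  split=> //; rewrite ltn_neqAle ik andbT; apply: contraNneq tj => /val_inj ki.
  by move: kt; rewrite -ki /source fi eq_sym.
rewrite big_pred0 // => k; apply/negP => /and3P[ik kt ti]; case/negP: tS.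
rewrite finset.in_setD1; apply/andP; split.
  apply: contraTneq ik => tj; rewrite tj in kt.
  by rewrite (source_inj ff kt (k := i)) ?ltnn // /source fi eqxx.
by apply/opensP; split=> //; exists k => //; exact: ltnW.
Qed.

End Prefixes.

(** * The descending induction *)

Section MomentFormula.
Variables (C : numClosedFieldType) (V : lmodType C).
Variables (ip : V -> V -> C) (alpha q : C).
Hypothesis ip_linear : forall u, linear (ip u : V -> C^o).
Hypothesis ip_hermitian : forall u v, ip v u = (ip u v)^*.
Variables (n : nat) (x : signed n -> V) (T : signed n -> {linear V -> V}).
Variable lam : signed n -> C.
Implicit Types (f g : links n) (S : {set 'I_n}) (i j k : 'I_n).

Local Notation chain := (chain x (fun p => T p : V -> V)).
Local Notation end_weight := (end_weight ip x (fun p => T p : V -> V) lam).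

Definition link_weight f i : C :=
  alpha ^+ negative_link f i * q ^+ (\sum_(k < n | (i < k)%N) crossing f i k) *
  (if final f i then end_weight f i else 1).

Lemma partition_weight f : linking f ->
  alpha ^+ Na (link_part f) * q ^+ Rc (link_part f) *
    partition_cumulant ip x (fun p => T p) lam (link_part f) =
  \prod_i link_weight f i.
Proof.
move=> ff; rewrite Na_part // Rc_part // !expr_sum partition_cumulant_part //.
by rewrite [X in _ * X = _]big_mkcond /= -!big_split.
Qed.

Definition legs g S : word V :=
  [seq (chain g (j, false), chain g (j, true)) | j <- enum S].

Local Notation moment_from := (moment_from ip alpha q x T lam).

Lemma chain_relink g S i a j s : link_prefix g S i -> link_source a \subset S ->
  (j < i)%N -> chain (relink g i a) (j, s) = chain g (j, s).
Proof.
move=> gS aS ji; have [gg _ _] := gS.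
have [gg' _ _] := prefix_relink true gS aS.
apply: chain_local => // k /= kj; rewrite ffunE; case: (eqVneq k i) => // ki.
by move: ji; rewrite -ki ltnNge kj.
Qed.

Lemma legs_relink g S i a : link_prefix g S i -> link_source a \subset S ->
  legs (relink g i a) (S :\: link_source a) = legs g (S :\: link_source a).
Proof.
move=> gS aS; have [_ _ gS'] := gS; apply/eq_in_map => j.
rewrite mem_enum finset.in_setD => /andP[_ /gS'[ji _]].
by rewrite !(chain_relink _ gS aS ji).
Qed.

Lemma legs_reopen g S i a : link_prefix g S i -> link_source a \subset S ->
  legs (relink g i a) (reopen S i a true) =
  rcons (legs g (S :\: link_source a))
    (chain (relink g i a) (i, false), chain (relink g i a) (i, true)).
Proof.
move=> gS aS; have [_ _ gS'] := gS.
rewrite -(legs_relink gS aS) /legs -map_rcons -enum_setU1_max // => j.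
by rewrite finset.in_setD => /andP[_ /gS'[]].
Qed.

Lemma sum_option (A : finType) (F : option A -> C) :
  \sum_a F a = F None + \sum_l F (Some l).
Proof.
rewrite (bigD1 None) //=; congr (_ + _).
transitivity (\sum_(a in Some @: [set: A]) F a).
  apply: eq_bigl => -[l|]; first by rewrite imset_f ?inE.
  by apply/esym/imsetP => -[].
rewrite big_imset /=; last by move=> u v _ _ [].
by apply: eq_bigl => l; rewrite inE.
Qed.

Lemma link_weight_None f i : f i = None ->
  link_weight f i = if ~~ final f i then 1 else lam (i, false) * lam (i, true).
Proof.
move=> fi; rewrite /link_weight /negative_link fi big1 => [|k _].
  by rewrite !expr0 !mul1r /end_weight fi; case: final.
by rewrite /crossing fi.
Qed.

Lemma link_weight_Some f i j (b : bool) : linking f -> f i = Some (j, b) ->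
  link_weight f i = alpha ^+ b * q ^+ shift_cost b j (opens f i :\ j) *
    if ~~ final f i then 1
    else ip (x (i, false)) (chain f (j, b (+) false)) *
         ip (x (i, true)) (chain f (j, b (+) true)).
Proof.
move=> ff fi; rewrite /link_weight (crossing_sum ff fi) /negative_link fi.
by rewrite /end_weight /link_step /= fi; case: final.
Qed.

(** The weight of [i], expressed only through the current state, the link chosen and the flag [o]
    for [i] staying open. *)
Definition choice_weight g S i (a : option ('I_n * bool)) (o : bool) : C :=
  if a is Some (j, b) then
    alpha ^+ b * q ^+ shift_cost b j (S :\ j) *
    if o then 1 else ip (x (i, false)) (chain g (j, b (+) false)) *
                     ip (x (i, true)) (chain g (j, b (+) true))
  else if o then 1 else lam (i, false) * lam (i, true).

Lemma choice_weightE g S i f : link_prefix g S i -> extends g S i f ->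
  link_weight f i = choice_weight g S i (f i) (~~ final f i).
Proof.
move=> gS fS; have /fintype.subsetP fiS := extends_source fS.
have /and3P[ff /forallP fg /eqP SE] := fS.
rewrite /choice_weight; case fi: (f i) => [[j b]|]; last exact: link_weight_None.
rewrite (link_weight_Some ff fi) SE; congr (_ * _); case: ifP => // _.
have [gg _ gS'] := gS; have [ji _] : (j < i)%N /\ final g j.
  by apply: gS'; apply: fiS; rewrite fi inE.
have chE s : chain f (j, s) = chain g (j, s).
  apply: chain_local => // k /= kj; apply/eqP.
  exact: (implyP (fg k) (leq_ltn_trans kj ji)).
by rewrite !chE.
Qed.

Lemma sum_choice g S i :
  link_prefix g S i ->
  \sum_(f | extends g S i f) \prod_(k < n | (i <= k)%N) link_weight f k =
  \sum_(a : option ('I_n * bool) | link_source a \subset S) \sum_(o : bool)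
    choice_weight g S i a o *
    \sum_(f | extends (relink g i a) (reopen S i a o) i.+1 f)
       \prod_(k < n | (i < k)%N) link_weight f k.
Proof.
move=> gS.
rewrite (partition_big (fun f : links n => f i) (fun a => link_source a \subset S));
  last by move=> f; exact: extends_source.
apply: eq_bigr => a aS.
rewrite (partition_big (fun f : links n => ~~ final f i) predT) //=.
apply: eq_bigr => o _; rewrite big_distrr /=.
apply: eq_big => [f|f /andP[/andP[fS /eqP fi] /eqP fo]].
  by rewrite -andbA extends_relink.
rewrite (bigD1 i) //= (choice_weightE gS fS) fi fo; congr (_ * _).
by apply: eq_bigl => k; rewrite ltn_neqAle andbC eq_sym.
Qed.

(** Induction on [n - m]: each link and flag chosen at [m] corresponds to one term of operator
    number [m] on the word of open points. *)
Lemma sum_extends m g S : (m <= n)%N -> link_prefix g S m ->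
  \sum_(f | extends g S m f) \prod_(i < n | (m <= i)%N) link_weight f i =
  moment_from (drop m (enum 'I_n)) (tens (legs g S)).
Proof.
move=> mn; have [d dE] : exists d, d = (n - m)%N by exists (n - m)%N.
elim: d m g S mn dE => [|d IH] m g S mn dE gS.
  have {mn dE} mE : m = n by apply/eqP; rewrite eqn_leq mn -subn_eq0 -dE.
  subst m; rewrite drop_oversize ?size_enum_ord // /moment_from /=.
  rewrite vacuum_coef_tens // size_map -cardE finset.cards_eq0.
  (* After all operators nothing is open: the sum is empty unless [S] is, and then [g] is its only
     term. *)
  have opens0 f : opens f n = finset.set0.
    apply/setP => j; rewrite finset.in_set0; apply/opensP => -[_ [k]].
    by rewrite leqNgt ltn_ord.
  case: eqVneq => [->|S0]; last first.
    by rewrite big_pred0 // => f; rewrite /extends opens0 eq_sym (negPf S0) !andbF.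
  rewrite (big_pred1 g) => [|f].
    by rewrite big_pred0 // => i; rewrite leqNgt ltn_ord.
  rewrite /extends opens0 eqxx andbT; apply/andP/eqP => [[_ /forallP fg]|->].
    by apply/ffunP => i; apply/eqP; have := fg i; rewrite ltn_ord.
  by case: gS => gg _ _; split=> //; apply/forallP => i; rewrite eqxx implybT.
have mn' : (m < n)%N by rewrite -subn_gt0 -dE.
pose i := Ordinal mn'; have {}gS : link_prefix g S i := gS.
have -> : drop m (enum 'I_n) = i :: drop i.+1 (enum 'I_n).
  rewrite (drop_nth i) ?size_enum_ord //; congr (_ :: _).
  by apply: val_inj; rewrite /= nth_enum_ord.
rewrite (sum_choice gS) [RHS]moment_from_set; last exact: ip_linear.
set s := drop i.+1 _.
have sumE a o : link_source a \subset S ->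
    \sum_(f | extends (relink g i a) (reopen S i a o) i.+1 f)
       \prod_(k < n | (i < k)%N) link_weight f k =
    moment_from s (tens (legs (relink g i a) (reopen S i a o))).
  by move=> aS; apply: IH => //; [rewrite subnS -dE|exact: prefix_relink].
rewrite (eq_bigr (fun a => \sum_(o : bool) choice_weight g S i a o *
    moment_from s (tens (legs (relink g i a) (reopen S i a o)))));
  last by move=> a aS; apply: eq_bigr => o _; rewrite sumE.
rewrite big_mkcond sum_option /= finset.sub0set.
have [gg g0 gS'] := gS.
(* The new outermost factor: [x] without a link (creation), [T] applied to the factor of [j] with
   one (gauge). *)
have top a t : link_source a \subset S -> chain (relink g i a) (i, t) =
    if a is Some (j, b) then T (i, t) (chain g (j, b (+) t)) else x (i, t).
  move=> aS; have [gg' _ _] := prefix_relink true gS aS.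
  rewrite chainE // ffunE /= eqxx; case: a aS gg' => [[j b]|] // aS gg'.
  rewrite /link_step ffunE /= eqxx; congr (T _ _).
  apply: (chain_relink _ gS aS).
  by have [] := gS' j (fintype.subsetP aS j (set11 _)).
(* Without a link, [o] chooses between the creation term and the scalar term. *)
congr (_ + _).
  rewrite big_bool addrC /= legs_reopen ?finset.sub0set // !top ?finset.sub0set //.
  by rewrite /reopen legs_relink ?finset.sub0set // finset.setD0 mul1r.
have pairE (F : 'I_n * bool -> C) : \sum_l F l = \sum_j \sum_(b : bool) F (j, b).
  by rewrite pair_bigA; apply: eq_bigr => -[].
(* With the link [(j, b)], [o] chooses between the gauge and annihilation terms on the factor of
   [j], and [b] between straight and crossed. *)
rewrite pairE [RHS]big_mkcond; apply: eq_bigr => j _ /=.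
case: ifPn => jS; last first.
  by rewrite big1 // => b _; rewrite finset.sub1set (negPf jS).
apply: eq_bigr => b _; have aS : link_source (Some (j, b)) \subset S.
  by rewrite /= finset.sub1set.
rewrite -[finset.set1 j]/(link_source (Some (j, b))) aS big_bool.
rewrite legs_reopen // !top // [reopen _ _ _ false]/(_ :\: _) legs_relink //=.
by rewrite -/(legs g (S :\ j)); case: (b) => /=; ring.
Qed.

Theorem moment_formula :
  vacuum_coef ip alpha q (foldl (fun v i => poisson ip alpha q x T lam i v)
    vacuum (enum 'I_n)) =
  \sum_(pi : {set {set signed n}} | typeB_partition pi)
    alpha ^+ Na pi * q ^+ Rc pi *
    partition_cumulant ip x (fun p => T p) lam pi.
Proof.
rewrite sum_typeB (eq_bigr _ partition_weight).
pose g0 : links n := [ffun=> None].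
have g0P : link_prefix g0 finset.set0 0.
  split=> [|i _|j]; rewrite ?ffunE ?inE //.
  by apply/linkingP; split=> [i j|i k j]; rewrite /source ffunE.
(* Every linking extends the empty prefix with no open points. *)
transitivity (\sum_(f | extends g0 finset.set0 0 f)
  \prod_(i < n | (0 <= i)%N) link_weight f i).
  rewrite (sum_extends _ g0P) // drop0 /moment_from /legs.
  by have -> : enum (finset.set0 : {set 'I_n}) = [::] by apply/eqP; rewrite -size_eq0 -cardE cards0.
apply: eq_bigl => f; rewrite /extends; case: linking => //=.
apply/andP; split; first exact/forallP.
by apply/eqP/setP => j; rewrite !inE.
Qed.

End MomentFormula.

(** * Order of the operators and conclusion *)

Lemma map_rev_ord n : map (@rev_ord n) (enum 'I_n) = rev (enum 'I_n).
Proof.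
apply: (inj_map val_inj); rewrite map_rev val_enum_ord -map_comp.
apply: (@eq_from_nth _ 0%N) => [|k].
  by rewrite size_rev size_map size_iota size_enum_ord.
rewrite size_map size_enum_ord => kn.
have kn' := rev_ord_proof (Ordinal kn).
rewrite (nth_map (Ordinal kn)) ?size_enum_ord //= nth_enum_ord //.
by rewrite nth_rev ?size_iota // nth_iota.
Qed.

(** The rightmost operator, of index 0, acts first, so a product with decreasing indices is a left
    fold over increasing ones. *)
Lemma big_comp_rev_ord (A : Type) n (F : 'I_n -> A -> A) (a : A) :
  (\big[comp/id]_(i < n) F (rev_ord i)) a =
  foldl (fun a i => F i a) a (enum 'I_n).
Proof.
have -> : \big[comp/id]_(i < n) F (rev_ord i) =
    \big[comp/id]_(i <- enum 'I_n) F (rev_ord i) by rewrite [index_enum _]unlock -enumT.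
rewrite -(big_map (@rev_ord n) xpredT F) map_rev_ord -[in RHS](revK (enum _)).
rewrite foldl_rev; elim: (rev _) => [|i s IH]; first by rewrite big_nil.
by rewrite big_cons /= IH.
Qed.

Unset Implicit Arguments.
Local Open Scope complex_scope.

Theorem theorem4p10 (R : realType) (HR : completeNormedModType R)
    (dot : {dot HR for idfun})
    (dot_norm : forall h : HR, dot h h = `|h| ^+ 2)
    (HR_separable : exists A : set HR, countable A /\ dense A)
    (P : {pred complexification HR}) (D : subLmodType P)
    (D_dense : dense [set v : complexification HR | v \in P])
    (alpha q : R) (alpha_itv : -1 < alpha < 1) (q_itv : -1 < q < 1)
    (n : nat) (n_gt0 : (0 < n)%N)
    (x : signed n -> D)
    (x_real : forall i, exists h : HR, \val (x i) = real_vector h)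
    (lam : signed n -> R)
    (T : signed n -> {linear D -> D}) :
  let ip := fun u v : D => cdot dot (\val u) (\val v) in
  let B := fun i : 'I_n =>
    double_poisson ip alpha%:C q%:C (x (i, false)) (x (i, true))
      (T (i, false)) (T (i, true)) (lam (i, false))%:C (lam (i, true))%:C in
  vacuum_state ip alpha%:C q%:C (\big[comp/id]_(i < n) B (rev_ord i)) =
  \sum_(pi : {set {set signed n}} | typeB_partition pi)
    alpha%:C ^+ Na pi * q%:C ^+ Rc pi *
    partition_cumulant ip x (fun i => T i) (fun i => (lam i)%:C) pi.
Proof.
move=> ip B.
have ip_linear u : linear (ip u : D -> R[i]^o).
  by move=> a v w; rewrite /ip linearP; exact: cdot_linear.
have ip_hermitian u v : ip v u = (ip u v)^*%R by exact: cdot_hermitian.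
rewrite /vacuum_state big_comp_rev_ord.
exact: (moment_formula alpha%:C q%:C ip_linear ip_hermitian x T
  (fun i => (lam i)%:C)).
Qed.
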